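(* Let $R$ be a ring, let $\mathcal{X}$ be a non-empty class of right $R$-modules closed under isomorphisms, and let $M$ be a right $R$-module with a monomorphic $\mathcal{X}$-envelope $u:M\to X$ such that $\mathrm{End}(X)/J(\mathrm{End}(X))$ is a von Neumann regular right self-injective ring and idempotents lift modulo $J(\mathrm{End}(X))$. Let $M$ be $\mathcal{X}$-automorphism-invariant and assume that every direct summand of $M$ has an $\mathcal{X}$-envelope. Assume further that for $\mathcal{X}$-endomorphism-invariant modules, the finite exchange property implies the full exchange property. Then $M$ satisfies the full exchange property.
   Context: Rings are associative with identity, modules are unital right modules, $J(-)$ is the Jacobson radical. An $\mathcal{X}$-preenvelope of $M$ is a homomorphism $u:M\to X$ with $X\in\mathcal{X}$ such that every homomorphism $M\to X'$ with $X'\in\mathcal{X}$ factors through $u$. It is an $\mathcal{X}$-envelope if, moreover, every endomorphism $h$ of $X$ with $h\circ u=u$ is an automorphism; it is monomorphic if $u$ is a monomorphism. $M$ is $\mathcal{X}$-automorphism-invariant (resp. $\mathcal{X}$-endomorphism-invariant) if there is an $\mathcal{X}$-envelope $u:M\to X$ such that for every automorphism (resp. endomorphism) $g$ of $X$ there is an endomorphism $f$ of $M$ with $u\circ f=g\circ u$. A right $R$-module $M$ has the (full) exchange property if for every right $R$-module $A$ and any two direct sum decompositions $A=M'\oplus N=\bigoplus_{i\in I}A_i$ with $M'\cong M$ there are submodules $B_i\subseteq A_i$ with $A=M'\oplus\bigl(\bigoplus_{i\in I}B_i\bigr)$; it has the finite exchange property if this holds for all finite index sets $I$. *)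

(* Defs.v *)
From HB Require Import structures.
From mathcomp Require Import all_boot all_algebra.
From mathcomp Require Import all_classical.

Set Implicit Arguments.
Unset Strict Implicit.
Unset Printing Implicit Defensive.

Import GRing.Theory.
Local Open Scope classical_set_scope.
Local Open Scope quotient_scope.
Local Open Scope ring_scope.

(* Rings are [pzRingType]s: associative, with identity, possibly zero.  A right
   R-module is a left module over the converse ring R^c; for v in such a
   module and a : R, the scaled element [a *: v] is the product v.a. *)
Notation rmodType R := (lmodType R^c).

Section Submodules.
Context (S : pzRingType) (V : lmodType S).

(* A submodule U of V (a boolean predicate closed under the module operations),
   viewed as a module in its own right. *)
Record submodule_of (U : submodClosed V) :=
  Submodule { submod_val :> V; submod_valP : submod_val \in U }.

Context (U : submodClosed V).
HB.instance Definition _ := [isSub for @submod_val U].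
HB.instance Definition _ := [Choice of submodule_of U by <:].
HB.instance Definition _ := [SubChoice_isSubLmodule of submodule_of U by <:].
End Submodules.

Definition isomorphic (S : pzRingType) (V W : lmodType S) : Prop :=
  exists f : {linear V -> W}, bijective f.

(* V is the internal direct sum of the submodules U i: every element is, in a
   unique way, a sum of a finitely supported family of elements of the U i. *)
Definition direct_sum (S : pzRingType) (V : lmodType S) (I : Type)
    (U : I -> submodClosed V) : Prop :=
  forall v : V, exists! x : I -> V,
    [/\ forall i, x i \in U i,
        finite_set [set i | x i <> 0] &
        v = \sum_(i \in [set: {classic I}]) x i].

Definition direct_sum2 (S : pzRingType) (V : lmodType S)
    (U W : submodClosed V) : Prop :=
  direct_sum (fun b : bool => if b then U else W).

Definition direct_summand (S : pzRingType) (V : lmodType S)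
    (U : submodClosed V) : Prop :=
  exists W : submodClosed V, direct_sum2 U W.

(* The decomposition A = M' (+) (+)_i B i is indexed by [option I], with M' at
   index [None]. *)
Definition exchange_for (S : pzRingType) (M : lmodType S) (I : Type) : Prop :=
  forall (A : lmodType S) (M' N : submodClosed A) (C : I -> submodClosed A),
    isomorphic (submodule_of M') M ->
    direct_sum2 M' N -> direct_sum C ->
    exists B : I -> submodClosed A,
      (forall i, {subset B i <= C i}) /\
      direct_sum (fun o : option I => if o is Some i then B i else M').

Definition full_exchange (S : pzRingType) (M : lmodType S) : Prop :=
  forall I : Type, exchange_for M I.

Definition finite_exchange (S : pzRingType) (M : lmodType S) : Prop :=
  forall I : Type, finite_set [set: I] -> exchange_for M I.

Section Envelopes.
Context (S : pzRingType) (XX : lmodType S -> Prop).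

Definition preenvelope (M X : lmodType S) (u : {linear M -> X}) : Prop :=
  XX X /\ forall (X' : lmodType S) (f : {linear M -> X'}), XX X' ->
    exists g : {linear X -> X'}, g \o u =1 f.

Definition envelope (M X : lmodType S) (u : {linear M -> X}) : Prop :=
  preenvelope u /\
  forall h : {linear X -> X}, h \o u =1 u -> bijective h.

Definition endomorphism_invariant (M : lmodType S) : Prop :=
  exists (X : lmodType S) (u : {linear M -> X}), envelope u /\
    forall g : {linear X -> X}, exists f : {linear M -> M}, u \o f =1 g \o u.

Definition automorphism_invariant (M : lmodType S) : Prop :=
  exists (X : lmodType S) (u : {linear M -> X}), envelope u /\
    forall g : {linear X -> X}, bijective g ->
      exists f : {linear M -> M}, u \o f =1 g \o u.

End Envelopes.

Lemma linear_ext (S : pzRingType) (V W : lmodType S) (f g : {linear V -> W}) :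
  f =1 g -> f = g.
Proof.
move=> /funext; case: f g => [f [[f1] [f2]]] [g [[g1] [g2]]] /= efg.
by case: g / efg g1 g2 => g1 g2; congr GRing.Linear.Pack;
  congr GRing.Linear.Class; congr (_ _); exact: Prop_irrelevance.
Qed.

(* The endomorphism ring of V, with multiplication (f * g) v = f (g v). *)
Section EndRing.
Context (S : pzRingType) (V : lmodType S).

Definition End : Type := {linear V -> V}.
Implicit Types f g h : End.

HB.instance Definition _ := gen_eqMixin End.
HB.instance Definition _ := gen_choiceMixin End.

Definition End_zero : End := (\0 : {linear V -> V}).
Definition End_opp f : End := (\- (f : {linear V -> V}) : {linear V -> V}).
Definition End_add f g : End :=
  ((f : {linear V -> V}) \+ (g : {linear V -> V}) : {linear V -> V}).
Definition End_one : End := (idfun : {linear V -> V}).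
Definition End_mul f g : End :=
  ((f : {linear V -> V}) \o (g : {linear V -> V}) : {linear V -> V}).

Fact End_addA : associative End_add.
Proof. by move=> f g h; apply: linear_ext => v /=; rewrite addrA. Qed.
Fact End_addC : commutative End_add.
Proof. by move=> f g; apply: linear_ext => v /=; rewrite addrC. Qed.
Fact End_add0 : left_id End_zero End_add.
Proof. by move=> f; apply: linear_ext => v /=; rewrite add0r. Qed.
Fact End_addN : left_inverse End_zero End_opp End_add.
Proof. by move=> f; apply: linear_ext => v /=; rewrite addNr. Qed.
HB.instance Definition _ :=
  GRing.isZmodule.Build End End_addA End_addC End_add0 End_addN.

Fact End_mulA : associative End_mul.
Proof. by move=> f g h; apply: linear_ext. Qed.
Fact End_mul1l : left_id End_one End_mul.
Proof. by move=> f; apply: linear_ext. Qed.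
Fact End_mul1r : right_id End_one End_mul.
Proof. by move=> f; apply: linear_ext. Qed.
Fact End_mulDl : left_distributive End_mul +%R.
Proof. by move=> f g h; apply: linear_ext. Qed.
Fact End_mulDr : right_distributive End_mul +%R.
Proof. by move=> f g h; apply: linear_ext => v /=; rewrite linearD. Qed.
HB.instance Definition _ := GRing.Zmodule_isPzRing.Build End
  End_mulA End_mul1l End_mul1r End_mulDl End_mulDr.
End EndRing.

Section Jacobson.
Context (Q : pzRingType).

Definition right_ideal (I : set Q) : Prop :=
  [/\ I 0, forall x y, I x -> I y -> I (x + y) & forall x a, I x -> I (x * a)].

Definition maximal_right_ideal (I : set Q) : Prop :=
  [/\ right_ideal I, I <> setT &
      forall K : set Q, right_ideal K -> I `<=` K -> K = I \/ K = setT].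

(* The Jacobson radical: the intersection of all maximal right ideals. *)
Definition jacobson : Q -> bool :=
  fun x => `[< forall I, maximal_right_ideal I -> I x >].

Fact jacobson_zmod_closed : zmod_closed jacobson.
Proof.
split=> [|x y /asboolP Jx /asboolP Jy]; apply/asboolP => I mI;
  have [[I0 ID IM] _ _] := mI; first exact: I0.
rewrite -mulrN1; apply: ID; first exact: Jx.
by apply: IM; exact: Jy.
Qed.
HB.instance Definition _ := GRing.isZmodClosed.Build Q jacobson
  jacobson_zmod_closed.

Fact jacobsonMr x a : x \in jacobson -> x * a \in jacobson.
Proof.
move=> /asboolP Jx; apply/asboolP => I mI; have [[_ _ IM] _ _] := mI.
by apply: IM; exact: Jx.
Qed.

Fact jacobsonMl a x : x \in jacobson -> a * x \in jacobson.
Proof.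
move=> /asboolP Jx; apply/asboolP => I mI; have [[I0 ID IM] IT Imax] := mI.
have [Ia|nIa] := pselect (I a); first exact: IM.
suff: maximal_right_ideal [set y | I (a * y)] by move=> /Jx.
split.
- split=> /= [|y z Iy Iz|y b Iy]; first by rewrite mulr0.
    by rewrite mulrDr; exact: ID.
  by rewrite mulrA; exact: IM.
- move=> aT; apply: nIa; rewrite -[a]mulr1.
  by have : [set y | I (a * y)] 1 by rewrite aT.
move=> K [K0 KD KM] subK.
have [KI|/existsNP[y /not_implyP[Ky nIy]]] :=
  pselect (forall y, K y -> I (a * y)); first by left; apply/seteqP; split.
right; pose L := [set z | exists2 t, I t & exists b, z = t + a * y * b].
have rL : right_ideal L.
  split.
  - by exists 0 => //; exists 0; rewrite mulr0 addr0.
  - move=> _ _ [t It [b ->]] [s Is [c ->]].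
    by exists (t + s); [exact: ID | exists (b + c); rewrite mulrDr addrACA].
  - move=> _ c [t It [b ->]].
    by exists (t * c); [exact: IM | exists (b * c); rewrite mulrDl !mulrA].
have IL : I `<=` L.
  by move=> t It; exists t => //; exists 0; rewrite mulr0 addr0.
have [LI|LT] := Imax _ rL IL.
  case: nIy; rewrite -LI; exists 0 => //; exists 1.
  by rewrite add0r mulr1.
have [t It [b ab]] : L a by rewrite LT.
have K1 : K 1.
  have -> : 1 = (1 - y * b) + y * b by rewrite subrK.
  apply: KD; last exact: KM.
  by apply: subK => /=; rewrite mulrBr mulr1 mulrA {1}ab addrK.
by apply/seteqP; split=> // z _; rewrite -[z]mul1r; exact: KM.
Qed.

(* The quotient ring Q / J(Q); its additive group is the library's quotient of
   an additive group by a subgroup. *)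
Definition jacobson_ideal : zmodClosed Q :=
  GRing.ZmodClosed.clone Q jacobson _.
Definition jacobson_quot : Type := {ideal_quot jacobson_ideal}.
HB.instance Definition _ := GRing.Zmodule.on jacobson_quot.
Local Notation pi := (\pi_({ideal_quot jacobson_ideal})).

Definition jacobson_quot_one : jacobson_quot := pi 1.
Definition jacobson_quot_mul (x y : jacobson_quot) : jacobson_quot :=
  pi (repr x * repr y).
Local Notation one := jacobson_quot_one.
Local Notation mul := jacobson_quot_mul.

Fact jacobson_quot_eq (x y : Q) : pi x = pi y <-> x - y \in jacobson.
Proof.
by rewrite (Quotient.idealrBE jacobson_ideal); split=> /eqP.
Qed.

Fact jacobson_quot_piD (x y : Q) : pi (x + y) = pi x + pi y :> jacobson_quot.
Proof. exact: Quotient.pi_add. Qed.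

Fact jacobson_quot_piM (x y : Q) : pi (x * y) = mul (pi x) (pi y).
Proof.
symmetry; apply/jacobson_quot_eq.
have repr_pi z : repr (pi z) - z \in jacobson.
  by apply/jacobson_quot_eq; rewrite reprK.
have -> : repr (pi x) * repr (pi y) - x * y =
    (repr (pi x) - x) * repr (pi y) + x * (repr (pi y) - y).
  by rewrite mulrBl mulrBr addrA subrK.
by apply: rpredD; [apply: jacobsonMr | apply: jacobsonMl].
Qed.

Fact jacobson_quot_mulA : associative mul.
Proof.
move=> x y z; rewrite -[x]reprK -[y]reprK -[z]reprK.
move: (repr x) (repr y) (repr z) => a b c.
by rewrite -(jacobson_quot_piM b) -(jacobson_quot_piM a) mulrA
  !jacobson_quot_piM.
Qed.
Fact jacobson_quot_mul1l : left_id one mul.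
Proof. by move=> x; rewrite -[x]reprK -jacobson_quot_piM mul1r. Qed.
Fact jacobson_quot_mul1r : right_id one mul.
Proof. by move=> x; rewrite -[x]reprK -jacobson_quot_piM mulr1. Qed.
Fact jacobson_quot_mulDl : left_distributive mul +%R.
Proof.
move=> x y z; rewrite -[x]reprK -[y]reprK -[z]reprK.
move: (repr x) (repr y) (repr z) => a b c.
by rewrite -jacobson_quot_piD -jacobson_quot_piM mulrDl jacobson_quot_piD
  !jacobson_quot_piM.
Qed.
Fact jacobson_quot_mulDr : right_distributive mul +%R.
Proof.
move=> x y z; rewrite -[x]reprK -[y]reprK -[z]reprK.
move: (repr x) (repr y) (repr z) => a b c.
by rewrite -jacobson_quot_piD -jacobson_quot_piM mulrDr jacobson_quot_piD
  !jacobson_quot_piM.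
Qed.
HB.instance Definition _ := GRing.Zmodule_isPzRing.Build jacobson_quot
  jacobson_quot_mulA jacobson_quot_mul1l jacobson_quot_mul1r
  jacobson_quot_mulDl jacobson_quot_mulDr.

Definition idempotents_lift_mod_jacobson : Prop :=
  forall e : Q, e * e - e \in jacobson ->
    exists f : Q, f * f = f /\ f - e \in jacobson.

End Jacobson.

Definition von_neumann_regular (Q : pzRingType) : Prop :=
  forall a : Q, exists b : Q, a * b * a = a.

Definition injective_module (S : pzRingType) (E : lmodType S) : Prop :=
  forall (V W : lmodType S) (i : {linear V -> W}) (f : {linear V -> E}),
    injective i -> exists g : {linear W -> E}, g \o i =1 f.

(* [Q^c^o] is the right regular module Q_Q: its scalar ring is Q^c, and
   [a *: v] is the product [v * a] of Q. *)
Definition right_self_injective (Q : pzRingType) : Prop :=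
  injective_module (Q^c^o : rmodType Q).

(* Main.v *)
(* Write H = End X and S = H / J(H).  The endomorphisms of X that preserve M
   form a subring of H that contains J(H) and all units, and restriction to M
   identifies End M with this subring modulo an ideal contained in J(H); so
   End M is governed by a subring T of S containing all units of S.
   Since T contains 1 + s whenever s^2 = 0, it contains every square-zero
   element of S.  As S is regular and right self-injective, a maximal pair of
   independent isomorphic right ideals yields orthogonal isomorphic idempotents
   yx and xy such that g = 1 - yx - xy has a reduced corner gSg, while the corner
   (1 - g)S(1 - g) is generated by square-zero elements, hence lies in T.
   Lifting g splits M as N (+) L.  Then L is endomorphism-invariant and has the
   finite exchange property, hence the full one by hypothesis.  The ring
   End N is strongly regular modulo an ideal that is closed under pointwise
   finite sums, which permits a transfinite orthogonalisation of any summable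
   family of sum 1 in End N and gives the full exchange property of N.
   The direct sum of N and L inherits full exchange (Crawley-Jonsson). *)

Require Import Defs.
From HB Require Import structures.
From mathcomp Require Import all_boot all_algebra.
From mathcomp Require Import all_classical wochoice.
Import GRing.Theory.
Local Open Scope classical_set_scope.
Local Open Scope ring_scope.

Set Implicit Arguments.
Unset Strict Implicit.
Unset Printing Implicit Defensive.

(** * Submodules given by predicates and linear maps given by functions *)

Section SubmoduleOfProp.
Context (S : pzRingType) (V : lmodType S) (P : V -> Prop).
Hypotheses (P0 : P 0) (Plin : forall a v w, P v -> P w -> P (a *: v + w)).

Let Pb : V -> bool := fun v => `[< P v >].
Let Pb_closed : submod_closed Pb.
Proof.
split=> [|a v w /asboolP Pv /asboolP Pw]; first exact/asboolP.
by apply/asboolP; exact: Plin.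
Qed.
HB.instance Definition _ := GRing.isSubmodClosed.Build S V Pb Pb_closed.

Lemma ex_submodClosed : exists U : submodClosed V, forall v, v \in U <-> P v.
Proof.
exists (GRing.SubmodClosed.clone S V Pb _) => v.
by split=> [/asboolP|?] //; exact/asboolP.
Qed.
End SubmoduleOfProp.

Lemma linear_of_fun (S : pzRingType) (V W : lmodType S) (f : V -> W) :
  linear f -> exists g : {linear V -> W}, forall v, g v = f v.
Proof.
move=> lf.
pose F := GRing.isLinear.Build S V W *:%R f lf.
by exists (HB.pack_for {linear V -> W} f F).
Qed.

(** * Regular right self-injective rings *)

Section MaximalSquareZero.
Context (Q : pzRingType).
Hypothesis Qreg : von_neumann_regular Q.

Lemma regular_annihilator1 (e a : Q) : e * e = e ->
  exists e', [/\ e' * e' = e', e * e' = e', a * e' = 0 &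
    forall s, e * s = s -> a * s = 0 -> e' * s = s].
Proof.
move=> ee; have [w bwb] := Qreg (a * e); pose e' := e - e * w * (a * e).
have ae' : a * e' = 0 by rewrite mulrBr !mulrA -(mulrA _ a e) bwb subrr.
have ee' : e * e' = e' by rewrite /e' mulrBr !mulrA ee.
have e'P s : e * s = s -> a * s = 0 -> e' * s = s.
  by move=> es as0; rewrite mulrBl es -!mulrA es as0 !mulr0 subr0.
by exists e'; split=> //; apply: e'P.
Qed.

Lemma regular_annihilator3 (a b c : Q) :
  exists e, [/\ a * e = 0, b * e = 0, c * e = 0 &
    forall s, a * s = 0 -> b * s = 0 -> c * s = 0 -> e * s = s].
Proof.
have [e1 [e11 _ ae1 e1P]] := regular_annihilator1 a (mulr1 1).
have [e2 [e22 e12 be2 e2P]] := regular_annihilator1 b e11.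
have [e3 [e33 e23 ce3 e3P]] := regular_annihilator1 c e22.
exists e3; split=> //.
- by rewrite -e23 -e12 !mulrA ae1 !mul0r.
- by rewrite -e23 mulrA be2 mul0r.
by move=> s *; apply: e3P => //; apply: e2P => //; apply: e1P; rewrite ?mul1r.
Qed.

(* [G] is the graph of an isomorphism between two right ideals with zero
   intersection, or is empty. *)
Definition partial_iso (G : set (Q * Q)) : Prop :=
  (forall p q s, G p -> G q -> G (p.1 + q.1 * s, p.2 + q.2 * s)) /\
  (forall p q, G p -> G q -> p.1 = q.2 -> p = 0 /\ q = 0).

(** Zorn's lemma also ranges over the empty chain, which is why the empty relation counts as a
    [partial_iso]. An empty maximal [G] is ruled out by comparison with [[set 0]]. *)
Lemma ex_maximal_partial_iso : exists G : set (Q * Q),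
  [/\ partial_iso G, G 0 & forall H, G `<=` H -> partial_iso H -> H `<=` G].
Proof.
have [|G [PG Gmax]] := @Zorn_bigcup _ partial_iso.
  move=> F FP Ftot.
  have two p q : (\bigcup_(X in F) X) p -> (\bigcup_(X in F) X) q ->
      exists X, [/\ F X, X p & X q].
    move=> [X FX Xp] [Y FY Yq]; case: (Ftot X Y FX FY) => sub.
      by exists Y; split=> //; exact: sub.
    by exists X; split=> //; exact: sub.
  split=> [p q s|p q] /two h /h{h} [X [FX Xp Xq]].
    by exists X => //; apply: (FP _ FX).1.
  by apply: (FP _ FX).2.
have max H : G `<=` H -> partial_iso H -> H `<=` G.
  by move=> GH PH; apply: contrapT => nHG; apply: (Gmax H).
exists G; split=> //.
have [[p Gp]|/forallNP G0] := pselect (exists p, G p).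
  by have := PG.1 p p (-1) Gp Gp; rewrite !mulrN1 !subrr.
apply: (max [set 0]) => [p /G0 //| |//].
split=> [p q s -> ->|p q -> -> //]; by rewrite /= !mul0r !addr0.
Qed.

Hypothesis Qinj : right_self_injective Q.

(** Independence embeds the direct sum of the domain and the range of [G] into [Q]. Self-injectivity
    extends to [Q] the map that is [G] on the domain and zero on the range, and likewise the inverse
    of [G]. Endomorphisms of the right module [Q] are left multiplications. *)
Lemma partial_iso_extend (G : set (Q * Q)) : partial_iso G -> G 0 ->
  exists x y : Q, forall p, G p ->
    [/\ x * p.1 = p.2, x * p.2 = 0, y * p.2 = p.1 & y * p.1 = 0].
Proof.
move=> [Glin Gind] G0.
have [||Z ZP] := @ex_submodClosed Q^c (Q^c^o * Q^c^o)%type G.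
- by [].
- move=> a v w Gv Gw; have := Glin w v a Gw Gv.
  by rewrite addrC [w.2 + _]addrC.
pose W := submodule_of Z.
pose V := (W * W)%type.
have lin_i : linear (fun v : V => (val v.1).1 + (val v.2).2 : Q^c^o).
  by move=> a v w /=; rewrite scalerDr addrACA.
have lin_f : linear (fun v : V => (val v.1).2 : Q^c^o).
  by move=> a v w /=.
have lin_h : linear (fun v : V => (val v.2).1 : Q^c^o).
  by move=> a v w /=.
have [i iE] := linear_of_fun lin_i.
have [f fE] := linear_of_fun lin_f.
have [h hE] := linear_of_fun lin_h.
have ZG (w : W) : G (val w) by apply/ZP; exact: valP.
have GN p : G p -> G (- p).
  by move=> /(Glin 0 p (-1) G0); rewrite !mulrN1 !add0r.
have inj_i : injective i.
  move=> v w /eqP; rewrite -subr_eq0 -linearB => /eqP; rewrite iE /= => /eqP.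
  rewrite addr_eq0 => /eqP e0.
  have [] := Gind (val (v - w).1) (- val (v - w).2); [exact: ZG|exact/GN/ZG|by []|].
  move=> /= e1 /eqP; rewrite oppr_eq0 => /eqP e2.
  apply/eqP; rewrite -subr_eq0; apply/eqP.
  rewrite [LHS]surjective_pairing; congr pair; exact: val_inj.
have [X XE] := Qinj f inj_i.
have [Y YE] := Qinj h inj_i.
have actE (Z' : {linear Q^c^o -> Q^c^o}) (s : Q) : Z' s = (Z' 1 : Q) * s.
  transitivity (Z' ((s : Q^c) *: (1 : Q^c^o))).
    by congr (Z' _); exact: esym (@mul1r Q s).
  by rewrite linearZ.
exists (X 1), (Y 1) => p Gp.
have pZ : p \in Z by apply/ZP.
pose w : W := Submodule pZ.
have XE' v : (X 1 : Q) * (i v : Q) = f v by rewrite -actE; exact: XE.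
have YE' v : (Y 1 : Q) * (i v : Q) = h v by rewrite -actE; exact: YE.
have i1 : i (w, 0) = p.1 by rewrite iE /= addr0.
have i2 : i (0, w) = p.2 by rewrite iE /= add0r.
by split; rewrite -?i1 -?i2 ?XE' ?YE' ?fE ?hE.
Qed.

(* Corresponds to a maximal pair of independent isomorphic right ideals, which
   injectivity realises as [y * x * Q] and [x * y * Q]. *)
Lemma maximal_square_zero : exists x y : Q,
  [/\ x * x = 0, y * y = 0, x * y * x = x, y * x * y = y &
   forall t, (1 - y * x - x * y) * t * (1 - y * x - x * y) = t ->
     t * t = 0 -> t = 0].
Proof.
have [G [PG G0 Gmax]] := ex_maximal_partial_iso.
have [x [y xyG]] := partial_iso_extend PG G0.
have [Glin Gind] := PG.
(* Every first component [s] of [G] satisfies [y * x * s = s], [x * x * s = 0] and [y * s = 0]. All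
   such [s] form the right ideal [e * Q], on which left multiplication by [x] is a partial
   isomorphism extending [G]; by maximality it is [G]. *)
have [e [ae be ce eP]] := regular_annihilator3 (1 - y * x) (x * x) y.
have yxe : y * x * e = e.
  by apply/eqP; rewrite eq_sym -subr_eq0 -{1}[e]mul1r -mulrBl ae.
have Ge s : G (e * s, x * (e * s)).
  pose H := [set p : Q * Q | exists s, p = (e * s, x * (e * s))].
  apply: (Gmax H); last by exists s.
  - move=> p Gp; have [xp xp' yp yp'] := xyG _ Gp.
    exists p.1; rewrite eP ?xp; first exact: surjective_pairing.
    + by rewrite mulrBl mul1r -mulrA xp yp subrr.
    + by rewrite -mulrA xp xp'.
    + by [].
  - split=> [_ _ r [s1 ->] [s2 ->]|_ _ [s1 ->] [s2 ->] /= e12].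
      by exists (s1 + s2 * r); rewrite /= !mulrDr !mulrA.
    have e20 : e * s2 = 0.
      by rewrite -yxe -!mulrA -e12 !mulrA ce mul0r.
    by rewrite e12 e20 !mulr0.
have eG p : G p -> e * p.1 = p.1.
  move=> Gp; have [xp xp' yp yp'] := xyG _ Gp.
  apply: eP => //; first by rewrite mulrBl mul1r -mulrA xp yp subrr.
  by rewrite -mulrA xp xp'.
have [xe xxe yxe' ye] := xyG _ (Ge 1); have ee := eG _ (Ge 1).
move: xe xxe yxe' ye ee => /= _; rewrite !mulr1 => xxe yxe' ye ee.
pose g := 1 - e * y * x - x * e * y.
have ge : g * e = 0.
  by rewrite !mulrBl mul1r -!mulrA yxe' ye !mulr0 subr0 ee subrr.
have gxe : g * (x * e) = 0.
  by rewrite !mulrBl mul1r -!mulrA xxe yxe' !mulr0 ee subr0 subrr.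
have gg : g * g = g.
  by rewrite {2}/g !mulrBr mulr1 !mulrA -(mulrA g x e) ge gxe !mul0r !subr0.
(* [e] need not annihilate [x * e], but the idempotent [e * y * x] does, and it still fixes [e];
   hence [x] is replaced by [x * (e * y * x)]. *)
exists (x * e * y * x), (e * y).
have xxeK z : x * (x * (e * z)) = 0 by rewrite (mulrA x e) mulrA xxe mul0r.
have yxeK z : y * (x * (e * z)) = e * z by rewrite (mulrA x e) mulrA yxe'.
have yeK z : y * (e * z) = 0 by rewrite mulrA ye mul0r.
have eeK z : e * (e * z) = e * z by rewrite mulrA ee.
have -> : x * e * y * x * (e * y) = x * e * y.
  by rewrite -!mulrA yxeK eeK.
have -> : e * y * (x * e * y * x) = e * y * x.
  by rewrite -!mulrA yxeK eeK.
split.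
- by rewrite -!mulrA xxeK !mulr0.
- by rewrite -!mulrA yeK mulr0.
- by rewrite -!mulrA yxeK eeK.
- by rewrite -!mulrA yxeK eeK.
move=> t; rewrite -/g; clearbody g => gtg tt.
have gt : g * t = t by rewrite -gtg !mulrA gg.
have tg : t * g = t by rewrite -gtg -!mulrA gg.
have [w twt] := Qreg t.
have gG p : G p -> g * p.1 = 0 /\ g * p.2 = 0.
  move=> Gp; have [<- _ _ _] := xyG _ Gp; rewrite -(eG _ Gp).
  by rewrite (mulrA x) (mulrA g e) (mulrA g (x * e)) ge gxe !mul0r.
(* The isomorphism sending [g * w * t * s] to [t * s] is adjoined to [G]. Its domain and range are
   independent because [t * t = 0] while [t * w * t = t], and independent of [G] because [g] fixes
   them and annihilates [G]. Maximality forces [t = g * t = 0]. *)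
pose H := [set p : Q * Q | exists2 q, G q & exists s,
  p = (q.1 + g * w * t * s, q.2 + t * s)].
have /(_ (g * w * t, t)) GH : H `<=` G.
  apply: Gmax.
  - move=> p Gp; exists p => //; exists 0.
    by rewrite !mulr0 !addr0 -surjective_pairing.
  split=> [_ _ s [p Gp [s1 ->]] [q Gq [s2 ->]]|
           _ _ [p Gp [s1 ->]] [q Gq [s2 ->]] /= pq].
    exists (p.1 + q.1 * s, p.2 + q.2 * s); first exact: Glin.
    by exists (s1 + s2 * s); congr pair; rewrite /= mulrDl mulrDr !mulrA addrACA.
  have [[gp1 gp2] [gq1 gq2]] := (gG _ Gp, gG _ Gq).
  have gwts : g * w * t * s1 = t * s2.
    have := congr1 ( *%R g) pq.
    by rewrite !mulrDr gp1 gq2 !add0r !mulrA gg gt.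
  have ts1 : t * s1 = 0.
    by have := congr1 ( *%R t) gwts; rewrite !mulrA tt mul0r tg twt.
  have ts2 : t * s2 = 0 by rewrite -gwts -mulrA ts1 mulr0.
  move: pq; rewrite -!(mulrA (g * w)) ts1 ts2 !mulr0 !addr0 => /(Gind _ _ Gp Gq).
  by case=> -> ->.
have : G (g * w * t, t).
  by apply: GH; exists 0 => //; exists 1; rewrite !mulr1 !add0r.
by move=> /gG[_] /=; rewrite gt.
Qed.
End MaximalSquareZero.

(** * The Jacobson radical *)

Definition invertible (Q : pzRingType) (x : Q) : Prop :=
  exists y, x * y = 1 /\ y * x = 1.

Section JacobsonRadical.
Context (Q : pzRingType).
Implicit Types a j x z : Q.

(** Zorn's lemma is applied to the sets [K] whose union with [I] is a proper right ideal, so that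
    the union of the empty chain is admissible. *)
Lemma right_ideal_sub_maximal (I : set Q) : right_ideal I -> ~ I 1 ->
  exists2 K : set Q, maximal_right_ideal K & I `<=` K.
Proof.
move=> rI nI1; pose P (K : set Q) := [/\ right_ideal (I `|` K) & ~ (I `|` K) 1].
have [F FP Ftot|K [[rK nK1] Kmax]] := @Zorn_bigcup _ P.
  have [->|/set0P[X0 FX0]] := eqVneq F set0.
    by rewrite /P bigcup_set0 setU0.
  have out X x : F X -> X x -> (I `|` \bigcup_(X in F) X) x.
    by move=> FX Xx; right; exists X.
  have sub X x : F X -> (I `|` X) x -> (I `|` \bigcup_(X in F) X) x.
    by move=> FX [Ix|]; [left|exact: out].
  have inX x : (I `|` \bigcup_(X in F) X) x -> exists2 X, F X & (I `|` X) x.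
    by case=> [Ix|[X FX Xx]]; [exists X0 => //; left|exists X => //; right].
  split; first split.
  - by left; case: rI.
  - move=> x y /inX[X FX Xx] /inX[Y FY Yy].
    have [XY|YX] := Ftot X Y FX FY.
      have [_ YD _] := (FP Y FY).1; apply: (sub Y) => //; apply: YD => //.
      by apply: setUS Xx.
    have [_ XD _] := (FP X FX).1; apply: (sub X) => //; apply: XD => //.
    by apply: setUS Yy.
  - move=> x a /inX[X FX Xx]; have [_ _ XM] := (FP X FX).1.
    by apply: (sub X) => //; exact: XM.
  - by move=> /inX[X FX]; apply: (FP X FX).2.
exists (I `|` K); last by move=> x; left.
split=> // [IKT|L rL IKL]; first by apply: nK1; rewrite IKT.
have IL : I `|` L = L by apply/setUidPr => x Ix; apply: IKL; left.
have [LI|nLI] := pselect (L `<=` I `|` K); first by left; apply/seteqP.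
right; apply/seteqP; split=> // x _.
have [L1|nL1] := pselect (L 1).
  by rewrite -[x]mul1r; case: rL => _ _; exact.
case: (Kmax L); last by rewrite /P IL.
split=> [y Ky|LK]; first by apply: IKL; right.
by case: nLI => y /LK Ky; right.
Qed.

(** A right inverse [y] exists because [1 - j] lies in no maximal right ideal. As [y = 1 + j * y]
    has the same form, it has a right inverse too, which must be [1 - j]. *)
Lemma jacobson_sub1_invertible j : j \in @jacobson Q -> invertible (1 - j).
Proof.
have rinv k : k \in @jacobson Q -> exists y : Q, (1 - k) * y = 1.
  move=> Jk; pose I := [set x | exists y, x = (1 - k) * y].
  have rI : right_ideal I.
    split=> [|_ _ [y ->] [z ->]|_ a [y ->]]; first by exists 0; rewrite mulr0.
      by exists (y + z); rewrite mulrDr.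
    by exists (y * a); rewrite mulrA.
  have [[y yE]|nI1] := pselect (I 1); first by exists y.
  have [K mK IK] := right_ideal_sub_maximal rI nI1.
  have [[K0 KD KM] KT _] := mK; case: KT; apply/seteqP; split=> // x _.
  rewrite -[x]mul1r; apply: KM; rewrite -(subrK k 1); apply: KD.
    by apply: IK; exists 1; rewrite mulr1.
  by move/asboolP: Jk; apply.
move=> Jj; have [y jy] := rinv j Jj.
have [|z yz] := rinv (- (j * y)); first by rewrite rpredN; exact: jacobsonMr.
have yE : 1 - - (j * y) = y by rewrite opprK -jy mulrBl mul1r subrK.
rewrite yE in yz; exists y; split=> //.
suff <- : z = 1 - j by [].
by rewrite -[LHS]mul1r -[X in X * z]jy -mulrA yz mulr1.
Qed.

Lemma mem_jacobson z : (forall a, invertible (1 + a * z)) -> z \in @jacobson Q.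
Proof.
move=> zunit; apply/asboolP => I mI; have [rI IT Imax] := mI.
have [I0 ID IM] := rI; apply: contrapT => nIz.
pose L := [set x | exists2 i, I i & exists a, x = i + z * a].
have rL : right_ideal L.
  split=> [|_ _ [i Ii [a ->]] [k Ik [b ->]]|_ b [i Ii [a ->]]].
  - by exists 0 => //; exists 0; rewrite mulr0 addr0.
  - by exists (i + k); [exact: ID|exists (a + b); rewrite mulrDr addrACA].
  - by exists (i * b); [exact: IM|exists (a * b); rewrite mulrDl mulrA].
have IL : I `<=` L by move=> i Ii; exists i => //; exists 0; rewrite mulr0 addr0.
have [LI|LT] := Imax L rL IL.
  apply: nIz; rewrite -LI; exists 0 => //; exists 1.
  by rewrite mulr1 add0r.
have [i Ii [a ia]] : L 1 by rewrite LT.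
have [y [ay ya]] := zunit (- a).
have iE : i = 1 - z * a by rewrite ia addrK.
apply: IT; apply/seteqP; split=> // x _; rewrite -[x]mul1r; apply: (IM).
(* The inverse [y] of [1 - a * z] yields the right inverse [1 + z * y * a] of [1 - z * a]. *)
have -> : 1 = i * (1 + z * y * a).
  have zE : (1 - z * a) * z = z * (1 + - a * z).
    by rewrite mulrBl mulrDr mul1r mulr1 mulNr mulrN mulrA.
  by rewrite iE mulrDr mulr1 !mulrA zE -(mulrA z) ay mulr1 subrK.
exact: IM.
Qed.

Definition jacobson_proj (x : Q) : jacobson_quot Q :=
  \pi_({ideal_quot (jacobson_ideal Q)})%qT x.

Lemma jacobson_projD x y :
  jacobson_proj (x + y) = jacobson_proj x + jacobson_proj y.
Proof. exact: jacobson_quot_piD. Qed.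
Lemma jacobson_projM x y :
  jacobson_proj (x * y) = jacobson_proj x * jacobson_proj y.
Proof. exact: jacobson_quot_piM. Qed.
Lemma jacobson_proj1 : jacobson_proj 1 = 1. Proof. by []. Qed.
Lemma jacobson_projB x y :
  jacobson_proj (x - y) = jacobson_proj x - jacobson_proj y.
Proof. by apply/eqP; rewrite eq_sym subr_eq -jacobson_projD subrK. Qed.

Lemma jacobson_proj0 : jacobson_proj 0 = 0.
Proof. by have := jacobson_projB 0 0; rewrite !subrr. Qed.

Lemma jacobson_proj_eq x z :
  jacobson_proj x = jacobson_proj z <-> x - z \in @jacobson Q.
Proof. exact: jacobson_quot_eq. Qed.

Lemma jacobson_proj_eq0 x : jacobson_proj x = 0 <-> x \in @jacobson Q.
Proof. by rewrite -jacobson_proj0 jacobson_proj_eq subr0. Qed.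

Lemma jacobson_proj_surj (s : jacobson_quot Q) : exists x, jacobson_proj x = s.
Proof. by exists (repr s)%qT; exact: reprK. Qed.

Lemma invertible_mod_jacobson x :
  invertible (jacobson_proj x) -> invertible x.
Proof.
have unit1 z : jacobson_proj z = 1 -> invertible z.
  move=> z1; rewrite -[z](subKr 1); apply: jacobson_sub1_invertible.
  by apply/jacobson_proj_eq0; rewrite jacobson_projB jacobson_proj1 z1 subrr.
move=> [s [xs sx]]; have [y yE] := jacobson_proj_surj s.
have [a [xya _]] : invertible (x * y) by apply: unit1; rewrite jacobson_projM yE.
have [b [_ byx]] : invertible (y * x) by apply: unit1; rewrite jacobson_projM yE.
exists (y * a); split; first by rewrite mulrA.
suff -> : y * a = b * y by rewrite -mulrA.
by rewrite -[y * a]mul1r -byx -!mulrA (mulrA x y a) xya mulr1.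
Qed.
End JacobsonRadical.

(** * Summable families of endomorphisms *)

Section Sums.
Context (S : pzRingType) (I : Type).
Implicit Types V W : lmodType S.

Definition fsupp V (F : I -> V) : Prop := finite_set [set i | F i <> 0].
Definition fsum V (F : I -> V) : V := \sum_(i \in [set: {classic I}]) F i.

Lemma fsupp_seq V (F : I -> V) : fsupp F ->
  exists2 s : seq {classic I}, uniq s & forall i : {classic I}, F i <> 0 -> i \in s.
Proof.
move=> /(@finite_seqP {classic I})[s sE]; exists (undup s); first exact: undup_uniq.
by move=> i Fi; rewrite mem_undup; move: Fi; rewrite -/([set i | F i <> 0] i) sE.
Qed.

Lemma fsum_seq V (F : I -> V) (s : seq {classic I}) : uniq s ->
  (forall i : {classic I}, F i <> 0 -> i \in s) -> fsum F = \sum_(i <- s) F i.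
Proof.
move=> us sP; rewrite /fsum (fsbigE s) //.
  by apply: eq_bigl => i; rewrite in_setT.
by move=> i _; apply: contraNeq => /eqP /sP.
Qed.

Lemma fsupp2 V W (F : I -> V) (G : I -> W) : fsupp F -> fsupp G ->
  exists2 s : seq {classic I}, uniq s &
    forall i : {classic I}, (F i <> 0 -> i \in s) /\ (G i <> 0 -> i \in s).
Proof.
move=> /fsupp_seq[s us sP] /fsupp_seq[t ut tP].
exists (undup (s ++ t)); first exact: undup_uniq.
by move=> i; rewrite mem_undup mem_cat; split=> [/sP->|/tP->]; rewrite ?orbT.
Qed.

Lemma fsupp_sub V W (F : I -> V) (G : I -> W) :
  (forall i, F i = 0 -> G i = 0) -> fsupp F -> fsupp G.
Proof. by move=> FG; apply: sub_finite_set => i /=; apply: contra_not => /FG. Qed.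

Lemma fsupp_of_seq V (F : I -> V) (s : seq {classic I}) :
  (forall i : {classic I}, F i <> 0 -> i \in s) -> fsupp F.
Proof. by move=> sP; apply: (sub_finite_set _ (finite_seq s)) => i /= /sP. Qed.

Lemma fsumD V (F G : I -> V) : fsupp F -> fsupp G ->
  fsupp (fun i => F i + G i) /\
  fsum (fun i => F i + G i) = fsum F + fsum G.
Proof.
move=> fF fG; have [s us sP] := fsupp2 fF fG.
have sFG (i : {classic I}) : F i + G i <> 0 -> i \in s.
  move=> FG; have [/(sP i).1//|/contrapT F0] := pselect (F i <> 0).
  by apply: (sP i).2; move: FG; rewrite F0 add0r.
split; first exact: fsupp_of_seq sFG.
rewrite !(fsum_seq us) ?big_split //= => i; [exact: (sP i).2|exact: (sP i).1].
Qed.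

Lemma fsum_additive V W (f : {additive V -> W}) (F : I -> V) : fsupp F ->
  fsupp (f \o F) /\ f (fsum F) = fsum (f \o F).
Proof.
move=> fF; have fFf : fsupp (f \o F).
  by apply: fsupp_sub fF => i /= ->; rewrite raddf0.
split=> //; have [s us sP] := fsupp2 fF fFf.
rewrite !(fsum_seq us) ?raddf_sum // => i; [exact: (sP i).2|exact: (sP i).1].
Qed.

Lemma fsum1 V (F : I -> V) j : (forall i, i <> j -> F i = 0) ->
  fsupp F /\ fsum F = F j.
Proof.
move=> F0; have sP (i : {classic I}) : F i <> 0 -> i \in [:: j : {classic I}].
  move=> Fi; rewrite inE; apply/eqP; apply: contrapT => ij.
  exact/Fi/F0.
split; first exact: fsupp_of_seq sP.
by rewrite (@fsum_seq _ _ [:: j]) // big_seq1.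
Qed.

Lemma eq_fsum V (F G : I -> V) : F =1 G -> fsum F = fsum G.
Proof. by move=> /funext ->. Qed.
End Sums.

Section EndApply.
Context (S : pzRingType) (V : lmodType S).
Implicit Types f g : End V.

Lemma EndP f g : (forall v, f v = g v) <-> f = g.
Proof. by split=> [fg|-> //]; exact: linear_ext. Qed.
Lemma EndM f g v : (f * g) v = f (g v). Proof. by []. Qed.
Lemma End1 v : (1 : End V) v = v. Proof. by []. Qed.
Lemma End0 v : (0 : End V) v = 0. Proof. by []. Qed.
Lemma EndD f g v : (f + g) v = f v + g v. Proof. by []. Qed.
Lemma EndN f v : (- f) v = - f v. Proof. by []. Qed.
Lemma EndB f g v : (f - g) v = f v - g v. Proof. by []. Qed.
Lemma End_sum (I : Type) (s : seq I) (F : I -> End V) v :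
  (\sum_(i <- s) F i) v = \sum_(i <- s) F i v.
Proof. by elim: s => [|i s IH]; rewrite ?big_nil // !big_cons -IH. Qed.
End EndApply.

Section Ssum.
Context (S : pzRingType) (V : lmodType S) (I : Type).
Implicit Types (a b : I -> End V) (f : End V).

Definition summable a : Prop := forall v, fsupp (fun i => a i v).

(** The implication stands below the quantifier so that [ssum] is total; its value on a family that
    is not summable is unspecified. *)
Lemma ex_ssum a : exists f, summable a -> forall v, f v = fsum (fun i => a i v).
Proof.
have [sa|nsa] := pselect (summable a); last by exists 0.
have lin : linear (fun v => fsum (fun i => a i v)).
  move=> c v w; have [sv fv] := fsum_additive (GRing.scale c) (sa v).
  rewrite fv -(fsumD sv (sa w)).2; apply: eq_fsum => i /=.
  by rewrite linearP.
by have [g gE] := linear_of_fun lin; exists g.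
Qed.

Definition ssum a : End V := projT1 (cid (ex_ssum a)).

Lemma ssumE a v : summable a -> ssum a v = fsum (fun i => a i v).
Proof. by move=> sa; exact: (projT2 (cid (ex_ssum a)) sa). Qed.

Lemma summable_sub a b : (forall i v, a i v = 0 -> b i v = 0) ->
  summable a -> summable b.
Proof. by move=> ab sa v; apply: fsupp_sub (sa v) => i; exact: ab. Qed.

Lemma summableMl (c : I -> End V) a : summable a -> summable (fun i => c i * a i).
Proof. by apply: summable_sub => i v av; rewrite EndM av linear0. Qed.

Lemma summableMr a f : summable a -> summable (fun i => a i * f).
Proof. by move=> sa v; exact: sa. Qed.

Lemma summableD a b : summable a -> summable b -> summable (fun i => a i + b i).
Proof. by move=> sa sb v; exact: (fsumD (sa v) (sb v)).1. Qed.

Lemma summableN a : summable a -> summable (fun i => - a i).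
Proof. by apply: summable_sub => i v av; rewrite EndN av oppr0. Qed.

Lemma ssumD a b : summable a -> summable b ->
  ssum (fun i => a i + b i) = ssum a + ssum b.
Proof.
move=> sa sb; apply/EndP => v.
by rewrite EndD !ssumE //; [exact: (fsumD (sa v) (sb v)).2|exact: summableD].
Qed.

Lemma ssumMl f a : summable a -> f * ssum a = ssum (fun i => f * a i).
Proof.
move=> sa; apply/EndP => v; rewrite EndM !ssumE //; last exact: summableMl.
exact: (fsum_additive f (sa v)).2.
Qed.

Lemma ssumMr a f : summable a -> ssum a * f = ssum (fun i => a i * f).
Proof.
by move=> sa; apply/EndP => v; rewrite EndM !ssumE //; exact: summableMr.
Qed.

Lemma ssumN a : summable a -> ssum (fun i => - a i) = - ssum a.
Proof.
move=> sa; rewrite -[RHS]mulN1r ssumMl //; congr ssum; apply/funext => i.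
by rewrite mulN1r.
Qed.

Lemma ssumB a b : summable a -> summable b ->
  ssum (fun i => a i - b i) = ssum a - ssum b.
Proof. by move=> sa sb; rewrite ssumD ?ssumN //; exact: summableN. Qed.

Lemma ssum1 a j : (forall i, i <> j -> a i = 0) -> summable a /\ ssum a = a j.
Proof.
move=> a0; have a0v v i : i <> j -> a i v = 0 by move=> /a0 ->.
have sa : summable a by move=> v; exact: (fsum1 (a0v v)).1.
by split=> //; apply/EndP => v; rewrite ssumE //; exact: (fsum1 (a0v v)).2.
Qed.
End Ssum.

(** * Direct sums, exchange and idempotents *)

Section Decompositions.
Context (S : pzRingType).
Implicit Types A M N L : lmodType S.

Definition decomposition A I (p : I -> End A) : Prop :=
  [/\ summable p, ssum p = 1 & forall i j, i <> j -> p i * p j = 0].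

Lemma decomposition_idem A I (p : I -> End A) : decomposition p ->
  forall i, p i * p i = p i.
Proof.
move=> [sp p1 porth] i; rewrite -[RHS]mulr1 -p1 ssumMl //.
by rewrite (@ssum1 _ _ _ _ i _).2 // => j ji; apply: porth => ij; apply: ji.
Qed.

(** Uniqueness of coordinates makes each coordinate map linear and forces an element of [C i] to
    have all its other coordinates zero. *)
Lemma direct_sumP A I (C : I -> submodClosed A) : direct_sum C <->
  exists2 p : I -> End A, decomposition p & forall i v, v \in C i <-> p i v = v.
Proof.
split=> [dC|[p dp pC] v].
  have [x xP] := choice dC.
  have xC v i : x v i \in C i by have [[]] := xP v.
  have xf v : fsupp (x v) by have [[]] := xP v.
  have xs v : fsum (x v) = v by have [[]] := xP v.
  have xu v y : (forall i, y i \in C i) -> fsupp y -> fsum y = v -> x v = y.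
    by move=> Cy fy sy; have [_] := xP v; apply.
  have lin i : linear (fun v => x v i).
    move=> c v w; have [sc fc] := fsum_additive (GRing.scale c) (xf v).
    have [sD fD] := fsumD sc (xf w).
    rewrite (xu _ (fun i => c *: x v i + x w i)) // => [j|].
      by apply: rpredD => //; exact: rpredZ.
    by rewrite fD -fc !xs.
  have [p pE] := choice (fun i => linear_of_fun (lin i)).
  have sp : summable (p : I -> End A).
    by move=> v; apply: fsupp_sub (xf v) => i xi; rewrite pE.
  have xdelta i v : v \in C i -> x v = fun j => if `[< j = i >] then v else 0.
    move=> Cv; pose d j := if `[< j = i >] then v else 0.
    have [|df ds] := @fsum1 _ _ _ d i; first by move=> j; rewrite /d; case: asboolP.
    apply: xu => // [j|]; first by case: asboolP => [->|_] //; exact: rpred0.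
    by rewrite ds /d; case: asboolP.
  exists p => [|i v].
    split=> // [|i j ij]; apply/EndP => v.
      by rewrite ssumE // -[RHS]xs; apply: eq_fsum => i; exact: pE.
    rewrite EndM !pE (xdelta j) //; by case: asboolP.
  rewrite pE; split=> [Cv|<- //].
  by rewrite (xdelta i) //; case: asboolP.
have [sp p1 porth] := dp; have pid := decomposition_idem dp.
exists (fun i => p i v); split.
  split=> [i||]; first by apply/pC; rewrite -EndM pid.
    exact: sp.
  by rewrite -[LHS]End1 -p1 ssumE.
move=> y [Cy fy yv]; apply/funext => i.
rewrite yv (fsum_additive (p i) fy).2 (@fsum1 _ _ _ _ i _).2 /=.
  exact/pC.
move=> j ji; have /pC <- := Cy j; rewrite -EndM porth // => ij; exact: ji.
Qed.

Lemma ssum_option A I (a : option I -> End A) :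
  summable (fun i => a (Some i)) ->
  summable a /\ ssum a = a None + ssum (fun i => a (Some i)).
Proof.
move=> sa; have aP v : fsupp (fun o => a o v) /\
    fsum (fun o => a o v) = a None v + fsum (fun i => a (Some i) v).
  have [s us sP] := fsupp_seq (sa v).
  pose t : seq {classic option I} := None :: [seq Some i | i <- s].
  have ut : uniq t.
    rewrite /= map_inj_uniq ?us ?andbT => [|i j []] //.
    by apply/mapP => -[].
  have tP (o : {classic option I}) : a o v <> 0 -> o \in t.
    case: o => [i ai|_]; rewrite inE; last by rewrite eqxx.
    by apply/orP; right; apply: map_f; exact: sP.
  split; first exact: fsupp_of_seq tP.
  by rewrite (fsum_seq ut tP) (fsum_seq us sP) big_cons big_map.
have sa' : summable a by move=> v; exact: (aP v).1.
by split=> //; apply/EndP => v; rewrite EndD !ssumE // (aP v).2.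
Qed.

(** The condition [m * p i * m = m * p i] says that [p i] maps the kernel of [m] into itself, so the
    [p i] decompose this kernel while [m] accounts for the rest. *)
Lemma decomposition_option A I (p : I -> End A) (m : End A) :
  decomposition p -> m * m = m -> (forall i, m * p i * m = m * p i) ->
  decomposition (fun o => if o is Some i then p i * (1 - m) else m).
Proof.
move=> [sp p1 porth] mm mp.
have mt i : m * (p i * (1 - m)) = 0 by rewrite mulrA mulrBr mulr1 mp subrr.
set t := fun o => _.
have [st ssumt] := ssum_option (summableMr (1 - m) sp : summable (t \o Some)).
split=> //; first by rewrite ssumt -ssumMr // p1 mul1r /= addrC subrK.
move=> [i|] [j|] //= ij.
  rewrite -mulrA mulrBl mt mul1r subr0 mulrA porth ?mul0r // => e.
  by apply: ij; rewrite e.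
by rewrite -mulrA mulrBl mm mul1r subrr mulr0.
Qed.
Lemma ssum_bool A (a : bool -> End A) : summable a /\ ssum a = a true + a false.
Proof.
have aP v : fsupp (fun b => a b v) /\ fsum (fun b => a b v) = a true v + a false v.
  have sP (b : {classic bool}) :
      a b v <> 0 -> b \in [:: true : {classic bool}; false].
    by rewrite !inE; case: b => _; rewrite eqxx ?orbT.
  split; first exact: fsupp_of_seq sP.
  by rewrite (fsum_seq _ sP) ?big_cons ?big_nil ?addr0 //= inE andbT; apply/eqP.
have sa : summable a by move=> v; exact: (aP v).1.
by split=> //; apply/EndP => v; rewrite EndD !ssumE // (aP v).2.
Qed.

Lemma decomposition_bool A (e : End A) : e * e = e ->
  decomposition (fun b : bool => if b then e else 1 - e).
Proof.
move=> ee; have [s sE] := ssum_bool (fun b : bool => if b then e else 1 - e).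
split=> //; first by rewrite sE addrC subrK.
by case=> [] [] // _; rewrite (mulrBr, mulrBl) ee ?mulr1 ?mul1r subrr.
Qed.

Lemma ex_submod_fix A (f : End A) :
  exists U : submodClosed A, forall v, v \in U <-> f v = v.
Proof.
by apply: ex_submodClosed => [|a v w fv fw]; rewrite ?linear0 // linearP fv fw.
Qed.

Definition splits M A (m : End A) : Prop :=
  exists (i : {linear M -> A}) (r : {linear A -> M}),
    (forall x, r (i x) = x) /\ (forall v, i (r v) = m v).

Lemma splits_idem M A (m : End A) : splits M m -> m * m = m.
Proof. by move=> [i [r [ri ir]]]; apply/EndP => v; rewrite EndM -!ir ri. Qed.

(* The exchange property in terms of projections: [m'] has the same image as [m],
   and its kernel is the direct sum of its intersections with the images of the
   [p i]. *)
Definition exchange_idem M I : Prop :=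
  forall A (m : End A) (p : I -> End A), splits M m -> decomposition p ->
  exists m' : End A, [/\ m' * m = m, m * m' = m' &
    forall i, m' * p i * m' = m' * p i].

Lemma splits_isomorphic M A (m : End A) (U : submodClosed A) :
  splits M m -> (forall v, v \in U <-> m v = v) -> isomorphic (submodule_of U) M.
Proof.
move=> [i [r [ri ir]]] UP.
have lin : linear (fun v : submodule_of U => r (val v)).
  by move=> a v w /=; rewrite linearP.
have [f fE] := linear_of_fun lin; exists f.
have iU x : i x \in U by apply/UP; rewrite -ir ri.
exists (fun x => Submodule (iU x)) => [v|x]; rewrite fE //=.
by apply: val_inj => /=; rewrite ir; apply/UP; exact: valP.
Qed.

Lemma isomorphic_splits M A (m : End A) (U : submodClosed A) :
  m * m = m -> (forall v, v \in U <-> m v = v) -> isomorphic (submodule_of U) M ->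
  splits M m.
Proof.
move=> mm UP [f [g fK gK]].
have glin : linear g by move=> a x y; rewrite -{1}[x]gK -{1}[y]gK -linearP fK.
have lin1 : linear (fun x => val (g x)) by move=> a x y; rewrite glin.
have mU v : m v \in U by apply/UP; rewrite -EndM mm.
have lin2 : linear (fun v => f (Submodule (mU v))).
  move=> a x y; rewrite -linearP; congr (f _); apply: val_inj => /=.
  by rewrite linearP.
have [i iE] := linear_of_fun lin1; have [r rE] := linear_of_fun lin2.
exists i, r; split=> [x|v]; last by rewrite iE rE fK.
rewrite rE -[RHS]gK; congr (f _); apply: val_inj => /=.
by rewrite iE; apply/UP; exact: valP.
Qed.

(** Given the [B i], [m'] is the projection onto [M'] along their sum. Conversely, [B i] is the
    image of [p i * (1 - m')], which is the part of [C i] in the kernel of [m']. *)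
Lemma exchange_forP M I : exchange_for M I <-> exchange_idem M I.
Proof.
split=> [exM A m p Mm dp|exM A M' N C isoM' dM' dC].
  have [U UP] := ex_submod_fix m; have [W WP] := ex_submod_fix (1 - m).
  have [C CP] := choice (fun i => ex_submod_fix (p i)).
  have dUW : direct_sum2 U W.
    apply/direct_sumP; exists (fun b : bool => if b then m else 1 - m).
      exact: decomposition_bool (splits_idem Mm).
    by case.
  have [|B [BC /direct_sumP[q dq qP]]] := exM A U W C (splits_isomorphic Mm UP) dUW.
    by apply/direct_sumP; exists p.
  have [sq q1 qorth] := dq; have qid := decomposition_idem dq.
  have [sp _ porth] := dp.
  have pq j : p j * q (Some j) = q (Some j).
    apply/EndP => v; apply/CP/BC/(qP (Some j)).
    by rewrite -EndM qid.
  exists (q None); split=> [||i].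
  - apply/EndP => v; apply/(qP None)/UP; by rewrite -EndM (splits_idem Mm).
  - apply/EndP => v; apply/UP/(qP None); by rewrite -EndM qid.
  rewrite -[RHS]mulr1 -q1 ssumMl // (@ssum1 _ _ _ _ None _).2 // => -[j|//] _.
  rewrite -pq -mulrA; have [->|ij] := pselect (j = i).
    by rewrite [p i * _]mulrA (decomposition_idem dp) pq qorth.
  by rewrite [p i * _]mulrA porth ?mul0r ?mulr0 // => e; apply: ij.
have [q dq qP] := (direct_sumP _).1 dM'.
have [p dp pP] := (direct_sumP _).1 dC.
have [sp p1 porth] := dp; have pid := decomposition_idem dp.
have qq := decomposition_idem dq true.
have Mm : splits M (q true) := isomorphic_splits qq (qP true) isoM'.
have [m' [m'm mm' m'p]] := exM A (q true) p Mm dp.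
have m'm' : m' * m' = m' by rewrite -{2}mm' mulrA m'm.
pose t o := if o is Some i then p i * (1 - m') else m'.
have dt : decomposition t by exact: decomposition_option.
have m't i : m' * t (Some i) = 0 by rewrite /= mulrA mulrBr mulr1 m'p subrr.
have [B BP] := choice (fun i => ex_submod_fix (t (Some i))).
exists B; split=> [i v /BP tv|].
  by apply/pP; rewrite -[in LHS]tv -EndM /t mulrA pid.
apply/direct_sumP; exists t => // -[i|] v; first exact: BP.
split=> [/(qP true) qv|/= <-]; first by rewrite /= -{1}qv -EndM m'm.
by apply/(qP true); rewrite -EndM mm'.
Qed.

End Decompositions.

(** * [End M] as a corner of [End A], for a retract [M] of [A] *)

Section Corner.
Context (S : pzRingType) (M A : lmodType S).
Context (i : {linear M -> A}) (r : {linear A -> M}).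
Implicit Types (f g : End M) (h : End A).

Definition extend f : End A := (i \o (f : {linear M -> M}) \o r : {linear A -> A}).
Definition compress h : End M := (r \o (h : {linear A -> A}) \o i : {linear M -> M}).

Lemma extendE f v : extend f v = i (f (r v)). Proof. by []. Qed.
Lemma compressE h x : compress h x = r (h (i x)). Proof. by []. Qed.
Lemma extend_mul_extend f g h :
  extend f * h * extend g = extend (f * compress h * g).
Proof. exact/EndP. Qed.

Lemma extendB f g : extend (f - g) = extend f - extend g.
Proof. by apply/EndP => v; rewrite EndB !extendE EndB linearB. Qed.

Hypothesis ri : forall x, r (i x) = x.

Lemma extendM f g : extend (f * g) = extend f * extend g.
Proof. by apply/EndP => v; rewrite EndM !extendE ri. Qed.
End Corner.

Section ExchangeDirectSum.
Context (S : pzRingType) (M N L : lmodType S) (e : End M).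
Hypotheses (Ne : splits N e) (Le : splits L (1 - e)).
Hypothesis exN : forall I, exchange_idem N I.
Hypothesis exL : forall I, exchange_idem L I.

(* Crawley-Jonsson: once [N] has been exchanged, [L] is exchanged in the
   refined decomposition that has the copy of [N] as an extra term. *)
Lemma exchange_idem_sum I : exchange_idem M I.
Proof.
move=> A m p [i [r [ri ir]]] dp.
have ee := splits_idem Ne.
pose n := extend i r e; pose l := extend i r (1 - e).
have splE P (f : End M) : splits P f -> splits P (extend i r f).
  move=> [j [s [sj js]]]; exists (i \o j), (s \o r); split=> [x|v] /=.
    by rewrite ri sj.
  by rewrite js.
have [nn nl ln ll] : [/\ n * n = n, n * l = 0, l * n = 0 & l * l = l].
  rewrite -!extendM // !mulrBr !mulrBl !mulr1 !mul1r ee subrr subr0.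
  by split=> //; apply/EndP => v; rewrite extendE End0 linear0.
have nlm : n + l = m.
  by apply/EndP => v; rewrite EndD !extendE -linearD -EndD addrC subrK ir.
have [a [an na ap]] := exN (splE _ _ Ne) dp.
have aa : a * a = a by rewrite -{2}na mulrA an.
have la : l * a = 0 by rewrite -na mulrA ln mul0r.
have dq := decomposition_option dp aa ap.
(* [L] is moved into the kernel of [a]: since [l * a = 0], [(1 - a) * l] is again an idempotent with
   image a copy of [L]. *)
have spl : splits L ((1 - a) * l).
  have [j [s [sj js]]] := splE _ _ Le.
  have sa v : s (a v) = 0 by rewrite -[s _]sj js -/l -EndM la End0 linear0.
  pose k : End A := 1 - a; have kE v : k v = v - a v by [].
  exists ((k : {linear A -> A}) \o j), s; split=> [x|v].
    by rewrite -[LHS]/(s (k (j x))) kE linearB sa subr0 sj.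
  by rewrite -[LHS]/(k (j (s v))) js.
have [b [bl lb bq]] := exL spl dq.
have ab : a * b = 0 by rewrite -lb 2!mulrA mulrBr mulr1 aa subrr !mul0r.
have ba : b * a = 0 by rewrite -(bq None) -mulrA ab mulr0.
have bn : b * n = 0 by rewrite -[X in b * X]an mulrA ba mul0r.
have bl' : b * l = (1 - a) * l by rewrite -[RHS]bl mulrA mulrBr mulr1 ba subr0.
have am : m * a = a by rewrite -nlm mulrDl na la addr0.
have ml : m * l = l by rewrite -nlm mulrDl nl ll add0r.
exists (a + b); split.
- rewrite -nlm mulrDl !mulrDr an bn bl' add0r -addrA -mulrDl (addrC a).
  by rewrite subrK mul1r.
- have mal : m * ((1 - a) * l) = (1 - a) * l.
    by rewrite mulrBl mul1r mulrBr mulrA am ml.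
  by rewrite mulrDr am -[in LHS]lb mulrA mal lb.
move=> j; have aj : a * p j * b = 0 by rewrite -ap -mulrA ab mulr0.
have bj : b * p j * b = b * p j * (1 - a).
  have := bq (Some j); rewrite /= mulrA -!(mulrA (b * p j)) => <-.
  by rewrite mulrBl mul1r ab subr0.
by rewrite !mulrDl !mulrDr ap aj addr0 bj -mulrDr (addrC a) subrK mulr1.
Qed.
End ExchangeDirectSum.

(* The criterion of Zimmermann-Huisgen and Zimmermann. *)
Definition exchange_criterion (S : pzRingType) (M : lmodType S) (I : Type) : Prop :=
  forall f : I -> End M, summable f -> ssum f = 1 ->
  exists r : I -> End M, decomposition (fun i => r i * f i).

Lemma exchange_criterion_idem (S : pzRingType) (M : lmodType S) (I : Type) :
  exchange_criterion M I -> exchange_idem M I.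
Proof.
move=> cM A m p [i [r [ri ir]]] dp; have [sp p1 porth] := dp.
have pid := decomposition_idem dp.
pose f j := compress i r (p j).
have sf : summable f by move=> x; exact: (fsum_additive r (sp (i x))).1.
have f1 : ssum f = 1.
  apply/EndP => x; rewrite ssumE // End1 -[RHS]ri -[i x]End1 -p1 ssumE //.
  by rewrite (fsum_additive r (sp (i x))).2.
have [s dsf] := cM f sf f1.
have esf := decomposition_idem dsf; have [ssf sf1 sforth] := dsf.
(* The factor [s j * f j] makes [d j * p j * d k] contain [s j * f j * (s k * f k)], which vanishes
   for distinct indices; without it only [s j * f j * s k] would appear. *)
pose d j := extend i r (s j * f j * s j).
have sdp : summable (fun j => d j * p j) by exact: summableMl.
have dpd j k : d j * p j * d k = extend i r (s j * f j * (s k * f k) * s k).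
  by rewrite extend_mul_extend -/(f j) -(mulrA (s j * f j) (s j)) esf mulrA.
have mp j : ssum (fun j => d j * p j) * p j = d j * p j.
  rewrite ssumMr // (@ssum1 _ _ _ _ j _).2 -?mulrA ?pid // => k kj.
  by rewrite -mulrA porth ?mulr0.
exists (ssum (fun j => d j * p j)); split.
- apply/EndP => v; rewrite ssumMr // ssumE; last exact: summableMr.
  rewrite -ir -[r v in RHS]End1 -sf1 ssumE //.
  rewrite (fsum_additive i (ssf _)).2; apply: eq_fsum => j.
  rewrite -[RHS]/(i ((s j * f j) (r v))) -[in RHS]esf.
  by rewrite -[LHS]/(i ((s j * f j) (s j (r (p j (m v)))))) -ir.
- rewrite ssumMl //; congr ssum; apply/funext => j; rewrite mulrA; congr (_ * _).
  by apply/EndP => v; rewrite EndM -ir extendE ri.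
move=> j; rewrite mp ssumMl // (@ssum1 _ _ _ _ j _).2 => [|k kj].
  by rewrite mulrA dpd esf.
rewrite mulrA dpd sforth => [|e]; last exact: kj.
by apply/EndP => v; rewrite EndM extendE mul0r !End0 linear0.
Qed.

(** * Exchange for semiregular endomorphism rings *)

Lemma ex_strict_well_order (I : Type) : exists lt : I -> I -> Prop,
  [/\ well_founded lt, forall i j k, lt i j -> lt j k -> lt i k &
      forall i j, i <> j -> lt i j \/ lt j i].
Proof.
have [R woR] := @well_ordering_principle {classic I}.
have minP (A : {pred {classic I}}) x : x \in A ->
    exists2 z, z \in A & forall y, y \in A -> R z y.
  by move=> xA; have [|z [[zA zmin] _]] := woR A; [exists x|exists z].
have anti : antisymmetric R.
  by move=> x y; apply: (wo_chain_antisymmetric (withinW woR (A := predT))).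
have tot x y : R x y \/ R y x.
  have [|z + zmin] := minP (mem [:: x; y]) x; first by rewrite inE eqxx.
  by rewrite !inE => /orP[] /eqP zE; [left|right]; rewrite -zE;
    apply: zmin; rewrite !inE eqxx ?orbT.
have trans x y z : R x y -> R y z -> R x z.
  move=> xy yz; have [|m + mmin] := minP (mem [:: x; y; z]) x.
    by rewrite inE eqxx.
  have [mx my mz] : [/\ R m x, R m y & R m z].
    by split; apply: mmin; rewrite !inE eqxx ?orbT.
  rewrite !inE => /or3P[] /eqP mE; rewrite mE in mx my mz => //.
    by rewrite (anti x y) ?xy.
  by rewrite -(anti y z) ?yz.
exists (fun i j => R i j /\ i <> j); split.
- move=> i; apply: contrapT => nAi.
  have [|m + mmin] := minP [pred j | ~~ `[< Acc (fun i j => R i j /\ i <> j) j >]] i.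
    by rewrite inE; apply/asboolPn.
  rewrite inE => /asboolPn; apply; constructor => y [ym neq].
  apply: contrapT => nAy; apply: neq; apply: anti; rewrite ym mmin //.
  by rewrite inE; apply/asboolPn.
- move=> i j k [ij nij] [jk njk]; split; first exact: trans jk.
  by move=> ik; apply: nij; apply: anti; rewrite ij ik jk.
move=> i j nij; have [ij|ji] := tot i j; first by left.
by right; split=> // /esym.
Qed.

(** [x] and [y] are [e * t * (1 - e)] and [(1 - e) * t * e], whose squares are always zero.
    Reducedness is asked of these two elements alone, since it will be available only in a corner or
    on the image of a map. *)
Lemma idem_comm (Q : pzRingType) (e t : Q) : e * e = e ->
  let x := e * t - e * t * e in let y := t * e - e * t * e in
  (x * x = 0 -> x = 0) -> (y * y = 0 -> y = 0) -> e * t = t * e.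
Proof.
move=> ee x y x0 y0.
have xe : x * e = 0 by rewrite mulrBl -!mulrA ee subrr.
have ey : e * y = 0 by rewrite mulrBr !mulrA ee subrr.
have xE : x = 0 by apply: x0; rewrite {2}/x mulrBr -mulrA !(mulrA x) xe !mul0r subrr.
have yE : y = 0 by apply: y0; rewrite {1}/y mulrBl -!mulrA ey !mulr0 subrr.
by rewrite -[LHS](subrK (e * t * e)) -/x xE -[RHS](subrK (e * t * e)) -/y yE.
Qed.

(* Here [q] is an idempotent sum of elements of [Q * F j]; the new idempotent [v]
   lies in [Q * F], is orthogonal to [(1 - v) * q], and [F] absorbs the sum. *)
Lemma exchange_step (Q : pzRingType) (q F w : Q) : q * q = q ->
  (F - F * q) * w * (F - F * q) = F - F * q ->
  let v := (w - q * w) * (F - F * q) * (w - q * w) * F in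
  [/\ q * v = 0, v * v = v & F * (v + (q - v * q)) = F].
Proof.
move=> qq; set c := F - F * q; set z := w - q * w => cwc v.
have cq : c * q = 0 by rewrite mulrBl -mulrA qq subrr.
have qz : q * z = 0 by rewrite mulrBr mulrA qq subrr.
have cz : c * z = c * w by rewrite [LHS]mulrBr mulrA cq mul0r subr0.
have Fz : F * z = c * z by rewrite [RHS]mulrBl -mulrA qz mulr0 subr0.
have Fq : F * q = F - c by rewrite subKr.
have czc : c * z * c = c by rewrite cz.
rewrite {}/v; clearbody c z.
have FzK x : F * (z * x) = c * (z * x) by rewrite !mulrA Fz.
have czK x : c * (z * (c * x)) = c * x by rewrite !mulrA czc.
have vq : z * c * z * F * q = z * c * z * F - z * c.
  rewrite -[LHS]mulrA Fq mulrBr; congr (_ - _).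
  by rewrite -!mulrA (mulrA c) czc.
split; first by rewrite !mulrA qz !mul0r.
  by rewrite -!mulrA FzK !czK.
by rewrite vq opprB addrCA (addrC (_ * F)) subrK mulrDr Fq mulrA Fz czc subrK.
Qed.

Section SemiregularMap.
Context (S : pzRingType) (P : lmodType S) (Q : pzRingType) (phi : End P -> Q).

(* Such a [phi] presents [End P] modulo the ideal [phi @^-1` [set 0]], which is
   contained in the Jacobson radical; the image need not contain [1 : Q]. *)
Record semiregular_map : Prop := SemiregularMap {
  srB : forall f g, phi (f - g) = phi f - phi g;
  srM : forall f g, phi (f * g) = phi f * phi g;
  sr_invertible : forall f, phi f = 0 -> invertible (1 - f);
  sr_regular : forall f, exists g, phi f * phi g * phi f = phi f;
  sr_lift : forall f, phi f * phi f = phi f ->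
    exists r, r * f * (r * f) = r * f /\ phi (r * f) = phi f }.

Hypothesis phiP : semiregular_map.
Let phiB := srB phiP.
Let phiM := srM phiP.

Lemma sr0 : phi 0 = 0. Proof. by rewrite -(subrr 0) phiB subrr. Qed.
Lemma srN f : phi (- f) = - phi f. Proof. by rewrite -sub0r phiB sr0 sub0r. Qed.
Lemma srD f g : phi (f + g) = phi f + phi g.
Proof. by rewrite -[g in LHS]opprK phiB srN opprK. Qed.
Lemma sr_sum (I : Type) (s : seq I) (F : I -> End P) :
  phi (\sum_(i <- s) F i) = \sum_(i <- s) phi (F i).
Proof. exact: (big_morph phi srD sr0). Qed.
Lemma sr1M f : phi 1 * phi f = phi f. Proof. by rewrite -phiM mul1r. Qed.

(* If the sum [h] were nonzero modulo the kernel, a nonzero idempotent [e] of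
   [(End P) h] would exist; on any vector of its range it agrees with a finite
   sum of elements of the kernel. *)
Lemma sr_ssum0 I (a : I -> End P) :
  summable a -> (forall i, phi (a i) = 0) -> phi (ssum a) = 0.
Proof.
move=> sa a0; set h := ssum a.
have [b hbh] := sr_regular phiP h.
have [|r [ee phie]] := sr_lift phiP (f := b * h).
  by rewrite phiM -mulrA (mulrA (phi h)) hbh.
suff e0 : r * (b * h) = 0.
  by rewrite -hbh -mulrA -phiM -phie e0 sr0 mulr0.
apply/EndP => v; set w := (r * (b * h)) v; rewrite End0.
have ew : r (b (h w)) = w by rewrite -[RHS]/((r * (b * h)) v) -[in RHS]ee.
have [s us sP] := fsupp_seq (sa w).
have [|y [_ yc]] := sr_invertible phiP (f := \sum_(i <- s) r * b * a i).
  by rewrite sr_sum big1 // => i _; rewrite phiM a0 mulr0.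
rewrite -[LHS]End1 -yc EndM EndB End1 End_sum.
have -> : \sum_(i <- s) (r * b * a i) w = (r * b) (\sum_(i <- s) a i w).
  by rewrite linear_sum.
by rewrite -(fsum_seq us sP) -ssumE // -/h EndM ew subrr linear0.
Qed.

(** Gaussian elimination: the equation is solved for [x h], and substitution changes each other
    [c i] by a term that [phi] annihilates. Hence the induction allows any [c i] that agree with the
    [b i] under [phi]. *)
Lemma sr_independent I (b : I -> End P) :
  (forall i, phi (b i) * phi (b i) = phi (b i)) ->
  (forall i j, i <> j -> phi (b i) * phi (b j) = 0) ->
  forall (s : seq {classic I}) (c : I -> End P) (x : I -> P), uniq s ->
    (forall i, phi (c i) = phi (b i)) -> (forall i, b i (x i) = x i) ->
    \sum_(i <- s) c i (x i) = 0 -> forall i : {classic I}, i \in s -> x i = 0.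
Proof.
move=> bb borth; elim=> [//|h s IH] c x /= /andP[hs us] cb bx.
rewrite big_cons; set T := \sum_(i <- s) _ => hT.
have [|y [_ yv]] := sr_invertible phiP (f := b h - b h * c h * b h).
  by rewrite phiB !phiM cb !bb subrr.
have xh : x h = - (y (b h T)).
  have cx : c h (x h) = - T by apply/eqP; rewrite -addr_eq0 hT.
  rewrite -[LHS]End1 -yv EndM EndB End1 EndB !EndM bx cx subKr.
  by rewrite linearN linearN.
have sx : forall i : {classic I}, i \in s -> x i = 0.
  (* The index [h] is not in [s]; the value [b h] there keeps the condition on [phi] true for every
     index. *)
  apply: (IH (fun i => if `[< i = h >] then b h else c i - c h * y * b h * c i)) => //.
  - move=> i; case: asboolP => [-> //|ih].
    rewrite phiB phiM [phi (_ * b h)]phiM -mulrA cb borth ?mulr0 ?subr0 //.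
    by move=> e; exact: ih.
  - transitivity (\sum_(i <- s) (c i (x i) - (c h * y * b h) (c i (x i)))).
      apply: eq_big_seq => i si; case: asboolP => // ih.
      by case/negP: hs; rewrite -ih.
    rewrite sumrB -/T.
    have -> : \sum_(i <- s) (c h * y * b h) (c i (x i)) = c h (y (b h T)).
      by rewrite -[RHS]/((c h * y * b h) T) linear_sum.
    by rewrite -linearN -xh addrC.
move=> i; rewrite inE => /orP[/eqP ->|]; last exact: sx.
rewrite xh; suff -> : T = 0 by rewrite !linear0.
by rewrite /T big_seq big1 // => j sj; rewrite sx ?linear0.
Qed.

(** Orthogonality modulo the kernel of [phi] is made exact. Each [r i * f i] is lifted to an
    idempotent [b i]; the sum of the [b i] has an inverse [y], and the [y * b i] are orthogonal
    because the images of the [b i] are independent. *)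
Lemma sr_decomposition I (f r : I -> End P) : summable f ->
  phi (ssum (fun i => r i * f i)) = phi 1 ->
  (forall i j, i <> j -> phi (r i * f i) * phi (r j * f j) = 0) ->
  exists r' : I -> End P, decomposition (fun i => r' i * f i).
Proof.
move=> sf; set E := fun i => r i * f i => E1 Eorth.
have sE : summable E by exact: summableMl.
have EE i : phi (E i) * phi (E i) = phi (E i).
  pose d j := if `[< j = i >] then 0 else E j * E i.
  have sd : summable d.
    apply: summable_sub (summableMr (E i) sE) => j v.
    by rewrite /d; case: asboolP => _ //.
  have : phi (ssum d) = 0.
    apply: sr_ssum0 => // j; rewrite /d; case: asboolP => [_|ji]; first exact: sr0.
    by rewrite phiM Eorth.
  have -> : ssum d = ssum E * E i - E i * E i.
    rewrite ssumMr //; pose d' j := if `[< j = i >] then E i * E i else 0.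
    have [|sd' d'E] := @ssum1 _ _ _ d' i.
      by move=> j; rewrite /d'; case: asboolP.
    have -> : E i * E i = ssum d' by rewrite d'E /d'; case: asboolP.
    rewrite -ssumB //; last exact: summableMr.
    congr ssum; apply/funext => j; rewrite /d /d'; case: asboolP => [->|_].
      by rewrite subrr.
    by rewrite subr0.
  by rewrite phiB phiM E1 sr1M phiM => /eqP; rewrite subr_eq0 => /eqP <-.
have [q qP] := choice (fun i => sr_lift phiP (EE i)).
pose b i := q i * E i.
have bb i : b i * b i = b i by have [] := qP i.
have phib i : phi (b i) = phi (E i) by have [] := qP i.
have sb : summable b by exact: summableMl.
have [|y [cy yc]] := sr_invertible phiP (f := 1 - ssum b).
  have : phi (ssum (fun i => b i - E i)) = 0.
    apply: sr_ssum0 => [|i]; last by rewrite phiB phib subrr.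
    by apply: summableD => //; exact: summableN.
  by rewrite ssumB // !phiB E1 => /eqP; rewrite subr_eq0 => /eqP ->; rewrite subrr.
rewrite subKr in cy yc.
exists (fun i => y * q i * r i).
have -> : (fun i => y * q i * r i * f i) = (fun i => y * b i).
  by apply/funext => i; rewrite /b /E !mulrA.
split; first exact: summableMl.
  by rewrite -ssumMl.
move=> i j ij; rewrite -mulrA; suff -> : b i * (y * b j) = 0 by rewrite mulr0.
apply/EndP => v; rewrite !EndM End0; set w := y (b j v).
(* The families [b k w] and [G k] both sum to [b j v] and have terms in the images of the [b k]; by
   independence they agree, and [G i = 0]. *)
pose G k := if `[< k = j >] then b j v else 0.
have [|sG GE] := @fsum1 _ _ _ G j; first by move=> k; rewrite /G; case: asboolP.
have Gj : G j = b j v by rewrite /G; case: asboolP.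
have [sF] := fsumD (sb w) (fsum_additive (-%R) sG).1.
rewrite -(fsum_additive (-%R) sG).2 GE Gj -ssumE // /w -!EndM mulrA cy mul1r.
rewrite subrr /= => F0.
have [s us sP] := fsupp_seq sF; rewrite (fsum_seq us sP) in F0.
have bbE k x : b k (b k x) = b k x by exact: (congr1 (fun f : End P => f x) (bb k)).
have bF k : b k (b k w - G k) = b k w - G k.
  rewrite linearB bbE; congr (_ - _); rewrite /G.
  by case: asboolP => [->|_]; rewrite ?bbE ?linear0.
have bb' k : phi (b k) * phi (b k) = phi (b k) by rewrite phib.
have borth k l : k <> l -> phi (b k) * phi (b l) = 0.
  by move=> kl; rewrite !phib Eorth.
have Fs := sr_independent bb' borth us (fun=> erefl) bF.
have {}F0 : \sum_(k <- s) b k (b k w - G k) = 0.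
  by rewrite -[RHS]F0; apply: eq_bigr => k _; rewrite bF.
have Gi : G i = 0 by rewrite /G; case: asboolP.
have [/(sP i)|/contrapT] := pselect (b i w - G i <> 0); last by rewrite Gi subr0.
by move=> /(Fs F0); rewrite Gi subr0.
Qed.

(** Induction on [s]: [exchange_step] supplies an idempotent [v] for the new index, and the earlier
    idempotents are multiplied on the left by [1 - v]. Setting [r] to zero outside [s] lets
    idempotence and orthogonality range over all indices. *)
Lemma sr_finite_orthogonal (I : Type) (f : I -> End P) (s : seq {classic I}) :
  uniq s -> exists r : I -> End P,
  [/\ forall i : {classic I}, i \notin s -> r i = 0,
      forall i, phi (r i * f i) * phi (r i * f i) = phi (r i * f i),
      forall i j, i <> j -> phi (r i * f i) * phi (r j * f j) = 0 &
      forall i : {classic I}, i \in s ->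
        phi (f i) * \sum_(j <- s) phi (r j * f j) = phi (f i)].
Proof.
elim: s => [_|h s IH /= /andP[hs us]].
  exists (fun _ => 0); split=> //.
  - by move=> i; rewrite mul0r sr0 mulr0.
  - by move=> i j _; rewrite !mul0r sr0 mulr0.
have [r [rs rid rorth rF]] := IH us.
pose g i := phi (r i * f i); pose q := \sum_(j <- s) g j.
have gs (i : {classic I}) : i \notin s -> g i = 0.
  by move=> /rs ri; rewrite /g ri mul0r sr0.
have qg (i : {classic I}) : q * g i = g i.
  have [si|/gs ->] := boolP ((i : {classic I}) \in s); last by rewrite mulr0.
  rewrite mulr_suml (bigD1_seq i) //= [g i * g i]rid big1 ?addr0 // => j /eqP.
  exact: rorth.
have gq (i : {classic I}) : g i * q = g i.
  have [si|/gs ->] := boolP ((i : {classic I}) \in s); last by rewrite mul0r.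
  rewrite mulr_sumr (bigD1_seq i) //= [g i * g i]rid big1 ?addr0 // => j /eqP.
  by move=> ji; apply: rorth => ij; exact: ji.
have qq : q * q = q by rewrite {2}/q mulr_sumr; apply: eq_bigr => i _; exact: qg.
pose p : End P := \sum_(j <- s) r j * f j.
have pq : phi p = q by rewrite sr_sum.
have [w wP] := sr_regular phiP (f h - f h * p).
pose z := w - p * w.
pose x := z * (f h - f h * p) * z.
have [qv vv Fv] : let v := phi (x * f h) in
    [/\ q * v = 0, v * v = v & phi (f h) * (v + (q - v * q)) = phi (f h)].
  move: wP; rewrite /x !phiM !phiB !phiM pq => wP.
  exact: exchange_step.
set v := phi (x * f h) in qv vv Fv.
have gv i : g i * v = 0 by rewrite -gq -mulrA qv mulr0.
pose r' (i : {classic I}) := if i == h then x else r i - x * f h * r i.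
have g'h : phi (r' h * f h) = v by rewrite /r' eqxx.
have g'E (i : {classic I}) : i != h -> phi (r' i * f i) = g i - v * g i.
  move=> /negPf ih; rewrite /r' ih mulrBl phiB.
  by rewrite -[x * f h * r i * f i]mulrA [X in _ - X]phiM.
have vg i : v * (g i - v * g i) = 0 by rewrite mulrBr mulrA vv subrr.
have gv' i : (g i - v * g i) * v = 0 by rewrite mulrBl -mulrA gv mulr0 subrr.
have gg' i j : (g i - v * g i) * (g j - v * g j) = g i * g j - v * (g i * g j).
  by rewrite mulrBr mulrA gv' mul0r subr0 mulrBl mulrA.
have sum' : \sum_(j <- h :: s) phi (r' j * f j) = v + (q - v * q).
  rewrite big_cons g'h /q mulr_sumr -sumrB; congr (_ + _).
  apply: eq_big_seq => j sj; apply: g'E; by apply: contraNneq hs => <-.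
exists r'; split.
- move=> i; rewrite inE negb_or => /andP[ih si].
  by rewrite /r' (negPf ih) rs // mulr0 subrr.
- move=> i; have [->|ih] := eqVneq (i : {classic I}) h; first by rewrite g'h.
  by rewrite (g'E i ih) gg' [g i * g i]rid.
- move=> i j ij; have [ih|ih] := eqVneq (i : {classic I}) h.
    rewrite ih g'h; have [jh|jh] := eqVneq (j : {classic I}) h.
      by case: ij; rewrite ih jh.
    by rewrite (g'E j jh).
  have [->|jh] := eqVneq (j : {classic I}) h; first by rewrite g'h (g'E i ih).
  by rewrite (g'E i ih) (g'E j jh) gg' [g i * g j]rorth // mulr0 subr0.
move=> i; rewrite inE sum' => /orP[/eqP -> //|/rF Fq].
rewrite -[in LHS]Fq -mulrA -/q mulrDr qv add0r mulrBr mulrA qv mul0r subr0.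
by rewrite qq.
Qed.

(** Let [q] be the sum of the orthogonal idempotents. Summing [phi (f i) * q = phi (f i)] over all
    indices gives [q = phi 1], because [f] sums to 1. *)
Lemma sr_finite_exchange (I : Type) :
  finite_set [set: I] -> exchange_criterion P I.
Proof.
move=> /(@finite_seqP {classic I})[s0 s0T] f sf f1.
pose s := undup s0; have us : uniq s := undup_uniq _.
have sT (i : {classic I}) : i \in s.
  by rewrite mem_undup; have : [set: {classic I}] i by []; rewrite s0T.
have [r [_ rid rorth rF]] := sr_finite_orthogonal f us.
apply: (sr_decomposition sf _ rorth).
have ssE (a : I -> End P) : summable a -> ssum a = \sum_(i <- s) a i.
  move=> sa; apply/EndP => v; rewrite ssumE // (fsum_seq us) ?End_sum //.
rewrite ssE; last exact: summableMl.
rewrite -[LHS]sr1M -f1 ssE // !sr_sum mulr_suml.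
by apply: eq_big_seq => i; exact: rF.
Qed.

(** * The reduced case, for arbitrary index sets *)

Section Reduced.
Hypothesis reduced : forall f, phi f * phi f = 0 -> phi f = 0.

Lemma sr_idem_central e f : phi e * phi e = phi e -> phi e * phi f = phi f * phi e.
Proof.
move=> ee; apply: idem_comm => //; rewrite -!phiM -phiB; exact: reduced.
Qed.

(** The idempotents [phi (e i)] are central, so finitely many become orthogonal on multiplying each
    by the earlier [1 - e k]. For infinite families, well-founded recursion defines [t i] as 1 minus
    the sum of the earlier [t k * e k], and [sr_ssum0] carries vanishing through the sums. *)
Lemma sr_reduced_exchange I : exchange_criterion P I.
Proof.
move=> f sf f1; have [lt [wf_lt lt_trans lt_tot]] := ex_strict_well_order I.
have lt_irr i : ~ lt i i.
  by elim/(well_founded_ind wf_lt): i => i IH ii; exact: (IH i).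
have [r rP] := choice (fun i => sr_regular phiP (f i)).
pose e i := r i * f i.
have ee i : phi (e i) * phi (e i) = phi (e i).
  by rewrite phiM -mulrA (mulrA (phi (f i))) rP.
have fe i : phi (f i) * phi (e i) = phi (f i) by rewrite phiM mulrA rP.
have se : summable e by exact: summableMl.
have ec i g : phi (e i) * phi g = phi g * phi (e i) by exact: sr_idem_central.
(* [pselect] provides the proof of [lt k i] that the recursive call requires; indices not below [i]
   contribute 0. *)
pose F i (rec : forall k, lt k i -> End P) : End P :=
  1 - ssum (fun k => if pselect (lt k i) is left h then rec k h * e k else 0).
pose t := Fix wf_lt (fun=> End P) F.
pose cut (D : I -> Prop) k := if `[< D k >] then t k * e k else 0.
have scut D : summable (cut D).
  apply: summable_sub (summableMl t se) => k v.
  by rewrite /cut; case: asboolP.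
have tE i : t i = 1 - ssum (cut (fun k => lt k i)).
  rewrite /t Fix_eq; last first.
    move=> j g1 g2 g12; congr (1 - ssum _); apply/funext => k.
    by case: pselect => // h; rewrite g12.
  congr (1 - ssum _); apply/funext => k; rewrite /cut.
  by case: pselect; case: asboolP.
(* [1 - ssum (cut D)] plays the role of the transfinite product of the [1 - e k],
   [k] in [D]. *)
have kill (D : I -> Prop) j : (forall k l, D l -> lt k l -> D k) -> D j ->
    (forall k, D k -> lt j k -> phi (t k * e j) = 0) ->
    phi ((1 - ssum (cut D)) * e j) = 0.
  move=> Ddown Dj IH.
  (* Terms with [k] before [j] cancel and the term at [j] is subtracted. For later [k] in [D], [phi]
     annihilates [t k * e j], hence also [t k * e k * e j] by centrality. *)
  pose y k := (cut D k - cut (fun l => lt l j) k) * e j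
    - (if `[< k = j >] then t j * e j * e j else 0).
  pose y' k := if `[< k = j >] then t j * e j * e j else 0.
  have [|sy' y'E] := @ssum1 _ _ _ y' j.
    by move=> k; rewrite /y'; case: asboolP.
  have sd : summable (fun k => (cut D k - cut (fun l => lt l j) k) * e j).
    by apply: summableMr; apply: summableD => //; exact: summableN.
  have : phi (ssum y) = 0.
    apply: sr_ssum0 => [|k]; first by apply: summableD => //; exact: summableN.
    rewrite /y /cut; case: (asboolP (k = j)) => [->|kj].
      case: asboolP => // _; case: asboolP => [/lt_irr//|_].
      by rewrite subr0 subrr sr0.
    rewrite subr0; case: (asboolP (lt k j)) => [ltkj|nltkj].
      case: asboolP => [_|nD]; first by rewrite subrr mul0r sr0.
      by case: nD; exact: Ddown ltkj.
    rewrite subr0; case: asboolP => [Dk|_]; last by rewrite mul0r sr0.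
    rewrite phiM [phi (t k * e k)]phiM -mulrA ec mulrA -[phi (t k) * _]phiM.
    rewrite IH ?mul0r //.
    by case: (lt_tot k j kj).
  rewrite ssumB // y'E /y'; case: asboolP => // _.
  rewrite -ssumMr; last by apply: summableD => //; exact: summableN.
  rewrite ssumB // => H.
  have -> : (1 - ssum (cut D)) * e j =
      (t j * e j - t j * e j * e j) -
      ((ssum (cut D) - ssum (cut (fun l => lt l j))) * e j - t j * e j * e j).
    rewrite opprB addrA subrK tE -mulrBl; congr (_ * _).
    by rewrite opprB addrA subrK.
  by rewrite phiB H subr0 phiB [X in _ - X]phiM phiM -mulrA ee subrr.
have kill_lt i : forall j, lt j i -> phi (t i * e j) = 0.
  elim/(well_founded_ind wf_lt): i => i IH j ji; rewrite tE.
  apply: kill => // [k l li kl|k ki]; first exact: lt_trans li.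
  exact: IH.
set T := 1 - ssum (cut (fun=> True)).
have Te j : phi T * phi (e j) = 0.
  by rewrite -phiM; apply: kill => // k _; exact: kill_lt.
have T0 : phi T = 0.
  rewrite -[T]mulr1 -f1 ssumMl //; apply: sr_ssum0 => [|i].
    by apply: summableMl.
  by rewrite phiM -fe -ec mulrA Te mul0r.
have cutT : cut (fun=> True) = (fun i => t i * r i * f i).
  by apply/funext => i; rewrite /cut; case: asboolP => // _; rewrite mulrA.
apply: (sr_decomposition sf (r := fun i => t i * r i)).
  by rewrite -cutT; apply/eqP; rewrite eq_sym -subr_eq0 -phiB; exact/eqP.
have phiE k : phi (t k * r k * f k) = phi (t k) * phi (e k).
  by rewrite -mulrA phiM.
move=> i j ij; rewrite !phiE; case: (lt_tot i j ij) => [lij|lji].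
  rewrite -mulrA (mulrA (phi (e i))) ec -(phiM (t j)) kill_lt //.
  by rewrite mul0r mulr0.
rewrite -(ec j) mulrA -(mulrA (phi (t i))) [phi (e i) * phi (e j)]ec.
by rewrite (mulrA (phi (t i))) -(phiM (t i)) kill_lt // !mul0r.
Qed.
End Reduced.
End SemiregularMap.

(** * Automorphism-invariant modules *)

(** Idempotents of a reduced corner are central in it, so [s * c] and [c * s] are the same
    idempotent [p], and [s] has an inverse [y] in the corner at [p]. Adding [1 - p] turns [y] into a
    unit of [Q]; a unit is wanted because units will be known to preserve [M]. *)
Lemma reduced_corner_unit_regular (Q : pzRingType) (g s b : Q) :
  g * g = g -> (forall t, g * t * g = t -> t * t = 0 -> t = 0) ->
  g * s * g = s -> s * b * s = s -> exists2 v, invertible v & s * v * s = s.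
Proof.
move=> gg gred gsg sbs0.
have gs : g * s = s by rewrite -gsg !mulrA gg.
have sg : s * g = s by rewrite -gsg -!mulrA gg.
pose c := g * b * g.
have gc : g * c = c by rewrite /c !mulrA gg.
have cg : c * g = c by rewrite /c -!mulrA gg.
have scs : s * c * s = s by rewrite /c !mulrA sg -mulrA gs.
clearbody c.
have comm h t : h * h = h -> g * h = h -> h * g = h -> g * t = t -> t * g = t ->
    h * t = t * h.
  move=> hh gh hg gt tg; apply: idem_comm => // x0; apply: gred => //.
    by rewrite mulrBr mulrBl !mulrA gh -!mulrA tg hg.
  by rewrite mulrBr mulrBl !mulrA gh gt -!mulrA hg.
have [p0 q0] : (s * c) * (s * c) = s * c /\ (c * s) * (c * s) = c * s.
  by rewrite mulrA scs -mulrA (mulrA s) scs.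
have [gp pg] : g * (s * c) = s * c /\ s * c * g = s * c.
  by rewrite mulrA gs -mulrA cg.
have [gq qg] : g * (c * s) = c * s /\ c * s * g = c * s.
  by rewrite mulrA gc -mulrA sg.
have cs : c * s = s * c.
  have e1 : s * c = (s * c) * (c * s).
    by rewrite -[LHS]p0 -!mulrA (mulrA c s c) (comm (c * s) c).
  have e2 : c * s = (c * s) * (s * c).
    by rewrite -[LHS]q0 -!mulrA (mulrA s c s) (comm (s * c) s).
  by rewrite [LHS]e2 [RHS]e1; apply: comm.
pose p := s * c; have pp : p * p = p by [].
have ps : p * s = s by [].
have sp : s * p = s by rewrite /p -cs mulrA.
pose y := c * p.
have yp : y * p = y by rewrite /y -mulrA pp.
have pc : p * c = c * p by rewrite /p [RHS]mulrA cs.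
have py : p * y = y by rewrite /y mulrA pc -mulrA pp.
have ys : y * s = p by rewrite /y -mulrA ps cs.
have sy : s * y = p by rewrite /y mulrA -/p pp.
have [n [np pn nn pn1]] : exists n, [/\ forall x, p * x = x -> n * x = 0,
    forall x, x * p = x -> x * n = 0, n * n = n & p + n = 1].
  exists (1 - p); split=> [x px|x xp||]; last by rewrite addrC subrK.
  - by rewrite mulrBl mul1r px subrr.
  - by rewrite mulrBr mulr1 xp subrr.
  - by rewrite mulrBr mulr1 mulrBl pp mul1r subrr subr0.
exists (y + n).
  exists (s + n); rewrite !mulrDl !mulrDr nn !np // !pn // ys sy.
  by rewrite !addr0 !add0r.
by rewrite mulrDr mulrDl sy ps pn // mul0r addr0.
Qed.

Section Bijective.
Context (S : pzRingType) (V : lmodType S).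

Lemma bijective_invertible (f : End V) :
  bijective (f : {linear V -> V}) -> invertible f.
Proof.
move=> [g fK gK].
have glin : linear g by move=> a x y; rewrite -{1}[x]gK -{1}[y]gK -linearP fK.
have [h hE] := linear_of_fun glin.
by exists h; split; apply/EndP => v; rewrite EndM hE ?gK ?fK.
Qed.
End Bijective.

(** * Endomorphisms of the envelope that preserve [M] *)

Section Envelope.
Context (S : pzRingType) (XX : lmodType S -> Prop) (M X : lmodType S).
Context (u : {linear M -> X}).
Hypothesis u_env : envelope XX u.
Hypothesis u_mono : injective u.
Hypothesis M_auto : automorphism_invariant XX M.
Implicit Types (g h k : End X) (f : End M).

Local Notation pr := (@jacobson_proj (End X)).

Lemma envelope_extend (f : {linear M -> X}) : exists g, forall x, g (u x) = f x.
Proof. by have [[XXX ext] _] := u_env; have [g gE] := ext X f XXX; exists g. Qed.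

(** For every [a], the endomorphism [1 + a * (g - h)] is the identity on the image of [u], hence an
    automorphism by the envelope property. *)
Lemma envelope_extend_unique g h : (forall x, g (u x) = h (u x)) -> pr g = pr h.
Proof.
move=> gh; apply/jacobson_proj_eq; apply: mem_jacobson => a.
apply: bijective_invertible; apply: u_env.2 => x.
by rewrite -[LHS]/(u x + a (g (u x) - h (u x))) gh subrr linear0 addr0.
Qed.

Definition preserves g : Prop := exists f, forall x, u (f x) = g (u x).

(** Automorphism-invariance provides some envelope [u'], not necessarily [u]. Hence [g] is
    conjugated by the isomorphism [a] with [a \o u = u'] and inverse [a']. *)
Lemma preserves_invertible g : invertible g -> preserves g.
Proof.
move=> gi; have [X' [u' [u'_env u'_auto]]] := M_auto.
have [a aE] := u_env.1.2 X' u' u'_env.1.1.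
have [b bE] := u'_env.1.2 X u u_env.1.1.
have {}aE x : a (u x) = u' x by exact: aE.
have {}bE x : b (u' x) = u x by exact: bE.
have [c [_ cba]] : invertible ((b \o a : {linear X -> X}) : End X).
  by apply: bijective_invertible; apply: u_env.2 => x; rewrite /= aE bE.
have abi : invertible ((a \o b : {linear X' -> X'}) : End X').
  by apply: bijective_invertible; apply: u'_env.2 => x; rewrite /= bE aE.
have [d [abd _]] := abi.
pose a' : {linear X' -> X} := (c : {linear X -> X}) \o b.
have a'K x : a' (a x) = x.
  by rewrite -[LHS]/((c * ((b \o a : {linear X -> X}) : End X)) x) cba.
have a'K' x : a (a' x) = x.
  have abdx y : a (b (d y)) = y.
    by rewrite -[LHS]/((((a \o b : {linear X' -> X'}) : End X') * d) y) abd.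
  by rewrite -[x]abdx -[a' _]/(a' (a (b (d x)))) a'K.
have [h [gh hg]] := gi.
pose G : {linear X' -> X'} := a \o (g : {linear X -> X}) \o a'.
have GE x : G x = a (g (a' x)) by [].
have [|f fE] := u'_auto G.
  exists (fun x => a (h (a' x))) => x; rewrite GE a'K.
    by rewrite -EndM hg End1 a'K'.
  by rewrite -EndM gh End1 a'K'.
exists f => x; have : u' (f x) = G (u' x) := fE x.
by rewrite -!aE GE a'K => /(can_inj a'K).
Qed.

Lemma preserves1 : preserves 1. Proof. by exists 1. Qed.
Lemma preservesB g h : preserves g -> preserves h -> preserves (g - h).
Proof.
by move=> [f fE] [f' f'E]; exists (f - f') => x; rewrite !EndB linearB fE f'E.
Qed.
Lemma preservesM g h : preserves g -> preserves h -> preserves (g * h).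
Proof.
by move=> [f fE] [f' f'E]; exists (f * f') => x; rewrite !EndM fE f'E.
Qed.

Lemma preserves_jacobson g : g \in @jacobson (End X) -> preserves g.
Proof.
move=> gJ; rewrite -[g](subKr 1); apply: preservesB; first exact: preserves1.
exact/preserves_invertible/jacobson_sub1_invertible.
Qed.

Definition stable (s : jacobson_quot (End X)) : Prop :=
  exists2 g, preserves g & pr g = s.
Implicit Types s t : jacobson_quot (End X).

(** Elements of the radical preserve [M], so preservation depends only on the class modulo the
    radical. *)
Lemma stable_preserves g : stable (pr g) -> preserves g.
Proof.
move=> [h hp hg]; rewrite -[g](subKr h); apply: preservesB => //.
by apply: preserves_jacobson; apply/jacobson_proj_eq.
Qed.

Lemma stable1 : stable 1. Proof. by exists 1 => //; exact: preserves1. Qed.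
Lemma stableB s t : stable s -> stable t -> stable (s - t).
Proof.
move=> [g gp <-] [h hp <-]; exists (g - h); first exact: preservesB.
exact: jacobson_projB.
Qed.
Lemma stableD s t : stable s -> stable t -> stable (s + t).
Proof.
move=> ss st; rewrite -[t]opprK; apply: stableB => //; rewrite -sub0r.
by apply: stableB => //; rewrite -(subrr t); exact: stableB.
Qed.
Lemma stableM s t : stable s -> stable t -> stable (s * t).
Proof.
move=> [g gp <-] [h hp <-]; exists (g * h); first exact: preservesM.
exact: jacobson_projM.
Qed.
Lemma stable_invertible s : invertible s -> stable s.
Proof.
have [g <-] := jacobson_proj_surj s => /invertible_mod_jacobson gi.
by exists g => //; exact: preserves_invertible.
Qed.
Lemma stable_square_zero s : s * s = 0 -> stable s.
Proof.
move=> ss; rewrite -[s](addrK 1); apply: stableB; last exact: stable1.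
apply: stable_invertible; exists (1 - s).
split; first by rewrite mulrDl mul1r mulrBr mulr1 ss subr0 addrC subrK.
by rewrite mulrBl mul1r mulrDr mulr1 ss add0r addrAC subrr add0r.
Qed.

(* The corner is a 2x2 matrix ring, hence additively and multiplicatively
   generated by square-zero elements. *)
Lemma stable_corner x y s :
  x * x = 0 -> y * y = 0 -> x * y * x = x -> y * x * y = y ->
  (y * x + x * y) * s * (y * x + x * y) = s -> stable s.
Proof.
move=> xx yy xyx yxy <-.
have xxK z : x * (x * z) = 0 by rewrite mulrA xx mul0r.
have yyK z : y * (y * z) = 0 by rewrite mulrA yy mul0r.
rewrite !mulrDl !mulrDr; apply: stableD; apply: stableD.
- have -> : y * x * s * (y * x) = (y * x * s * y) * x by rewrite !mulrA.
  apply: stableM; apply: stable_square_zero => //.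
  by rewrite -!mulrA yyK !mulr0.
- by apply: stable_square_zero; rewrite -!mulrA yyK !mulr0.
- by apply: stable_square_zero; rewrite -!mulrA xxK !mulr0.
- have -> : x * y * s * (x * y) = (x * y * s * x) * y by rewrite !mulrA.
  apply: stableM; apply: stable_square_zero => //.
  by rewrite -!mulrA xxK !mulr0.
Qed.

Hypothesis X_lift : idempotents_lift_mod_jacobson (End X).

Lemma lift_idempotent (k : End X) : pr k * pr k = pr k ->
  exists2 e : End X, e * e = e & pr e = pr k.
Proof.
move=> kk; have [|e [ee ek]] := X_lift (e := k).
  by apply/jacobson_proj_eq; rewrite jacobson_projM.
by exists e => //; apply/jacobson_proj_eq.
Qed.

Lemma preserves_idempotent (e : End X) : e * e = e -> preserves e ->
  exists2 f : End M, f * f = f & forall x, u (f x) = e (u x).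
Proof.
move=> ee [f fE]; exists f => //; apply/EndP => x; apply: u_mono.
by rewrite EndM !fE -EndM ee.
Qed.

(** * The endomorphism ring of a direct summand [P] of [M] *)

Section Summand.
Context (P : lmodType S) (i : {linear P -> M}) (r : {linear M -> P}) (e : End X).
Hypotheses (ri : forall x, r (i x) = x) (ee : e * e = e).
Hypothesis eu : forall x, e (u x) = u (i (r x)).

Local Notation represents f k := (forall x, k (u x) = u (extend i r f x)).

(** Extensions along [u] are unique modulo the radical, so the class of a representative depends on
    [f] alone. As [e] represents 1, [phi] sends 1 to [pr e]. *)
Lemma ex_summand_map : exists phi : End P -> jacobson_quot (End X),
  forall (f : End P) k, represents f k -> phi f = pr k.
Proof.
have [k kP] := choice (fun f : End P => envelope_extend
  (u \o (extend i r f : {linear M -> M}))).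
exists (fun f : End P => pr (k f)) => f h hP; apply: envelope_extend_unique => x.
by rewrite kP hP.
Qed.

Lemma ex_representative (f : End P) :
  exists k : End X, [/\ e * k = k, k * e = k & represents f k].
Proof.
have [k kP] := envelope_extend (u \o (extend i r f : {linear M -> M})).
exists (e * k * e); split; first by rewrite !mulrA ee.
  by rewrite -!mulrA ee.
move=> x; rewrite !EndM eu kP /= -[LHS]/(e (u (i (f (r (i (r x))))))) eu.
by rewrite !ri.
Qed.

Lemma represents_corner (k : End X) (f : End M) : (forall x, u (f x) = k (u x)) ->
  represents (compress i r f) (e * k * e).
Proof. by move=> fk x; rewrite !EndM eu -fk eu. Qed.

Hypothesis corner_regular : forall s, stable s -> pr e * s * pr e = s ->
  exists2 t, stable t & s * t * s = s.

Lemma summand_semiregular (phi : End P -> jacobson_quot (End X)) :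
  (forall (f : End P) k, represents f k -> phi f = pr k) -> semiregular_map phi.
Proof.
move=> phiE; split.
- move=> f g; have [k [_ _ kf]] := ex_representative f.
  have [h [_ _ hg]] := ex_representative g.
  rewrite (phiE _ _ kf) (phiE _ _ hg) -jacobson_projB; apply: phiE => x.
  by rewrite extendB !EndB linearB kf hg.
- move=> f g; have [k [_ _ kf]] := ex_representative f.
  have [h [_ _ hg]] := ex_representative g.
  rewrite (phiE _ _ kf) (phiE _ _ hg) -jacobson_projM; apply: phiE => x.
  by rewrite extendM // !EndM hg kf.
- move=> f f0; have [k [_ _ kf]] := ex_representative f.
  have kJ : k \in @jacobson (End X).
    by apply/jacobson_proj_eq0; rewrite -(phiE _ _ kf).
  have [y [ky yk]] := jacobson_sub1_invertible kJ.
  have [|q qE] := @preserves_invertible y; first by exists (1 - k).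
  have fq x : q x - extend i r f (q x) = x.
    apply: u_mono; rewrite linearB -kf !qE.
    by rewrite -[LHS]/(((1 - k) * y) (u x)) ky.
  have qf x : q (x - extend i r f x) = x.
    apply: u_mono; rewrite qE linearB -kf.
    by rewrite -[LHS]/((y * (1 - k)) (u x)) yk.
  exists (compress i r q); split; apply/EndP => x.
    rewrite EndM EndB !End1 compressE -[RHS]ri -[i x in RHS]fq.
    by rewrite linearB extendE ri.
  rewrite EndM EndB !End1 compressE -[RHS]ri -[i x in RHS]qf.
  by rewrite linearB extendE ri.
- move=> f; have [k [ek ke kf]] := ex_representative f.
  have kp : preserves k by exists (extend i r f) => x; rewrite kf.
  have [||t [h [m hm] ht] sts] := corner_regular (s := pr k).
  + by exists k.
  + by rewrite -!jacobson_projM ek ke.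
  exists (compress i r m); rewrite (phiE _ _ kf) (phiE _ _ (represents_corner hm)).
  have pke : pr k * pr e = pr k by rewrite -jacobson_projM ke.
  have pek : pr e * pr k = pr k by rewrite -jacobson_projM ek.
  by rewrite !jacobson_projM !mulrA pke -mulrA pek ht.
move=> f; have [k [ek ke kf]] := ex_representative f.
have kp : preserves k by exists (extend i r f) => x; rewrite kf.
rewrite (phiE _ _ kf) => kk; have [d dd dk] := lift_idempotent kk.
have dp : preserves d by apply: stable_preserves; exists k.
(* As [pr a = 1], [a] has an inverse [z], and [z * d * k = z * d * a] is a conjugate of [d]. It is
   thus an idempotent and a left multiple of [k], as a lift of the form [r * f] requires. *)
pose a := 1 - d + d * k.
have pra : pr a = 1.
  by rewrite jacobson_projD jacobson_projB jacobson_projM dk kk jacobson_proj1 subrK.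
have [z [az za]] : invertible a.
  by apply: invertible_mod_jacobson; rewrite pra; exists 1; rewrite mulr1.
have da : d * a = d * k by rewrite mulrDr mulrBr mulr1 mulrA dd subrr add0r.
have [m mE] : preserves (z * d).
  by apply: preservesM => //; apply: preserves_invertible; exists a.
have bb : z * d * k * (z * d * k) = z * d * k.
  by rewrite -(mulrA z d k) -da !mulrA -(mulrA _ a z) az mulr1 -(mulrA z d d) dd.
have rep : represents (compress i r m * f) (e * (z * d * k)).
  move=> x; rewrite extendE EndM compressE -eu mE -[i (f (r x))]/(extend i r f x).
  by rewrite -kf.
have KK : e * (z * d * k) * (e * (z * d * k)) = e * (z * d * k).
  by rewrite mulrA -(mulrA e _ e) -(mulrA (z * d)) ke -mulrA bb.
have prz : pr z = 1 by rewrite -[LHS]mulr1 -pra -jacobson_projM za.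
exists (compress i r m); split.
  apply/EndP => y; rewrite -[LHS]ri -[RHS]ri; congr (r _); apply: u_mono.
  have extE (f' : End P) : i (f' y) = extend i r f' (i y) by rewrite extendE ri.
  by rewrite !extE extendM // EndM -!rep -EndM KK.
rewrite (phiE _ _ rep) jacobson_projM (jacobson_projM _ k) jacobson_projM.
rewrite prz mul1r dk kk.
by rewrite -jacobson_projM ek.
Qed.
End Summand.

(** [b \o a] fixes [v], hence has an inverse [c], and [d] projects [X] onto a copy of [Y] and agrees
    with [e] modulo the radical. An endomorphism [g] of [Y] becomes [k] in the corner at [d]; its
    class is stable, so [k] restricts to [M], and compressing to [P] gives the map sought. *)
Lemma summand_endomorphism_invariant (P Y : lmodType S) (i : {linear P -> M})
    (r : {linear M -> P}) (e : End X) (v : {linear P -> Y}) :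
  (forall x, r (i x) = x) -> (forall x, e (u x) = u (i (r x))) ->
  (forall s, pr e * s * pr e = s -> stable s) -> envelope XX v ->
  endomorphism_invariant XX P.
Proof.
move=> ri eu estable v_env; exists Y, v; split=> // g.
have [a aE] := v_env.1.2 X (u \o i) u_env.1.1.
have [b bE] := u_env.1.2 Y (v \o r) v_env.1.1.
have {}aE x : a (v x) = u (i x) by exact: aE.
have {}bE x : b (u x) = v (r x) by exact: bE.
have bav x : b (a (v x)) = v x by rewrite aE bE ri.
have [c [bac cba]] : invertible ((b \o a : {linear Y -> Y}) : End Y).
  by apply: bijective_invertible; apply: v_env.2 => x; exact: bav.
have {}bac y : b (a (c y)) = y by exact: (congr1 (fun f : End Y => f y) bac).
have cv x : c (v x) = v x.
  by rewrite -[in LHS]bav; exact: (congr1 (fun f : End Y => f (v x)) cba).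
pose d : End X := (a \o (c : {linear Y -> Y}) \o b : {linear X -> X}).
pose k : End X := (a \o (c : {linear Y -> Y}) \o g \o b : {linear X -> X}).
have dE x : d x = a (c (b x)) by [].
have kE x : k x = a (c (g (b x))) by [].
have de : pr d = pr e.
  by apply: envelope_extend_unique => x; rewrite dE bE cv aE eu.
have dk : d * k = k by apply/EndP => x; rewrite EndM dE kE bac.
have kd : k * d = k by apply/EndP => x; rewrite EndM dE kE bac.
have [f fE] : preserves k.
  apply: stable_preserves; apply: estable.
  by rewrite -de -[in RHS]kd -[in RHS]dk !jacobson_projM.
exists (r \o (f : {linear M -> M}) \o i) => x.
by rewrite -[LHS]/(v (r (f (i x)))) -bE fE kE bE bac ri.
Qed.
End Envelope.

Lemma splits_submod (S : pzRingType) (M : lmodType S) (m : End M) :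
  m * m = m -> exists2 U : submodClosed M,
    direct_summand U & splits (submodule_of U) m.
Proof.
move=> mm; have [U UP] := ex_submod_fix m; have [W WP] := ex_submod_fix (1 - m).
exists U; last first.
  by apply: isomorphic_splits mm UP _; exists idfun; exists id.
exists W; apply/direct_sumP; exists (fun b : bool => if b then m else 1 - m).
  exact: decomposition_bool.
by case.
Qed.

Theorem theorem3p13 (R : pzRingType) (XX : rmodType R -> Prop)
  (XX_nonempty : exists V : rmodType R, XX V)
  (XX_iso : forall V W : rmodType R, isomorphic V W -> XX V -> XX W)
  (M X : rmodType R) (u : {linear M -> X})
  (u_envelope : envelope XX u)
  (u_mono : injective u)
  (EndX_regular : von_neumann_regular (jacobson_quot (End X)))
  (EndX_self_injective : right_self_injective (jacobson_quot (End X)))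
  (EndX_lift : idempotents_lift_mod_jacobson (End X))
  (M_automorphism_invariant : automorphism_invariant XX M)
  (summands_have_envelopes : forall U : submodClosed M, direct_summand U ->
     exists (Y : rmodType R) (v : {linear submodule_of U -> Y}), envelope XX v)
  (finite_exchange_full : forall N : rmodType R,
     endomorphism_invariant XX N -> finite_exchange N -> full_exchange N) :
  full_exchange M.
Proof.
have [x [y [xx yy xyx yxy gred]]] :=
  maximal_square_zero EndX_regular EndX_self_injective.
set g := 1 - y * x - x * y in gred.
have g1 : 1 - g = y * x + x * y by rewrite /g -addrA -opprD subKr.
have corner s : (1 - g) * s * (1 - g) = s -> stable u s.
  by rewrite g1; exact: (stable_corner u_envelope M_automorphism_invariant).
have nn : (1 - g) * (1 - g) = 1 - g.
  rewrite g1 mulrDl !mulrDr -!mulrA (mulrA x x) xx (mulrA y y) yy !mul0r !mulr0.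
  by rewrite addr0 add0r !mulrA yxy xyx.
have gg : g * g = g.
  by rewrite -[g](subKr 1) mulrBr mulr1 mulrBl mul1r nn subrr subr0.
(* [g] is stable because 1 and [1 - g] are; hence an idempotent [e] lifting [g] preserves [M] and
   restricts to an idempotent [m] of [End M]. *)
have [k k_pres kg] : stable u g.
  rewrite -[g](subKr 1); apply: (stableB (stable1 u)); apply: corner.
  by rewrite !nn.
have [|e ee] := lift_idempotent EndX_lift (k := k); first by rewrite kg.
rewrite kg => eg.
have [|m mm mE] := preserves_idempotent u_mono ee.
  apply: (stable_preserves u_envelope M_automorphism_invariant).
  by exists k; rewrite ?kg.
have idemB (Q : pzRingType) (f : Q) : f * f = f -> (1 - f) * (1 - f) = 1 - f.
  by move=> ff; rewrite mulrBr mulr1 mulrBl mul1r ff subrr subr0.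
have [U _ spU] := splits_submod mm.
have [W dW spW] := splits_submod (idemB _ _ mm).
(* The values of [phi] lie in the reduced corner at [g], where quasi-inverses can be chosen
   invertible and therefore stable. *)
have exU I : exchange_idem (submodule_of U) I.
  apply: exchange_criterion_idem.
  have [i [r [ri ir]]] := spU.
  have eu v : e (u v) = u (i (r v)) by rewrite ir mE.
  have [phi phiE] := ex_summand_map u_envelope i r.
  have sr : semiregular_map phi.
    apply: (summand_semiregular u_envelope u_mono M_automorphism_invariant
      EndX_lift ri ee eu _ phiE) => s _; rewrite eg => gsg.
    have [b sbs] := EndX_regular s.
    have [v v_inv svs] := reduced_corner_unit_regular gg gred gsg sbs.
    by exists v => //; exact: (stable_invertible u_envelope M_automorphism_invariant).
  apply: (sr_reduced_exchange sr) => f.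
  have [h [eh he hf]] := ex_representative u_envelope ri ee eu f.
  rewrite (phiE _ _ hf); apply: gred.
  by rewrite -eg -[in RHS]he -[in RHS]eh !jacobson_projM.
(* The whole corner at [1 - g] is stable: this gives endomorphism-invariance, and a quasi-inverse
   becomes stable once compressed into the corner. *)
have exW I : exchange_idem (submodule_of W) I.
  apply/exchange_forP; move: I.
  have [i [r [ri ir]]] := spW.
  have ne : jacobson_proj (1 - e) = 1 - g by rewrite jacobson_projB eg.
  have eu v : (1 - e) (u v) = u (i (r v)) by rewrite ir !EndB linearB mE.
  apply: finite_exchange_full.
    have [Y [v v_env]] := summands_have_envelopes W dW.
    apply: (summand_endomorphism_invariant u_envelope M_automorphism_invariant
      ri eu _ v_env) => s; rewrite ne; exact: corner.
  move=> I finI; apply/exchange_forP/exchange_criterion_idem.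
  have [phi phiE] := ex_summand_map u_envelope i r.
  apply: (sr_finite_exchange _ finI).
  apply: (summand_semiregular u_envelope u_mono M_automorphism_invariant
      EndX_lift ri (idemB _ _ ee) eu _ phiE) => s _; rewrite ne => nsn.
  have [b sbs] := EndX_regular s.
  have sn : s * (1 - g) = s by rewrite -nsn -mulrA nn.
  have ns : (1 - g) * s = s by rewrite -nsn !mulrA nn.
  exists ((1 - g) * b * (1 - g)).
    by apply: corner; rewrite !mulrA nn -!mulrA nn.
  by rewrite !mulrA sn -!mulrA ns mulrA.
by move=> I; apply/exchange_forP/(exchange_idem_sum spU spW exU exW).
Qed.
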